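(* Let $\ell\ge 1$ and $n\ge 2\ell+1$ be integers with $(n,\ell)\ne(5,2)$. Then the family of $n$-vertex acyclic graphs is $\ell$-recognizable; that is, if $F$ is an $n$-vertex acyclic graph and $G$ is an $n$-vertex graph having the same $(n-\ell)$-deck as $F$, then $G$ is acyclic.
   Context: All graphs are finite and simple. The $(n-\ell)$-deck of an $n$-vertex graph is the multiset (of isomorphism classes) of its induced subgraphs with $n-\ell$ vertices, i.e. those obtained by deleting $\ell$ vertices. A family of $n$-vertex graphs is $\ell$-recognizable if every $n$-vertex graph having the same $(n-\ell)$-deck as a graph in the family is also in the family. A graph is acyclic if it contains no cycle. *)

(* Defs.v *)
From mathcomp Require Import all_boot.

Set Implicit Arguments.
Unset Strict Implicit.
Unset Printing Implicit Defensive.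

Record sgraph := SGraph {
  svertex :> finType;
  sedge : rel svertex;
  sedge_sym : symmetric sedge;
  sedge_irr : irreflexive sedge
}.

Section Induced.
Variables (G : sgraph) (S : {set G}).

Definition induced_edge : rel {x : G | x \in S} :=
  fun x y => sedge (val x) (val y).

Lemma induced_edge_sym : symmetric induced_edge.
Proof. by move=> x y; apply: sedge_sym. Qed.

Lemma induced_edge_irr : irreflexive induced_edge.
Proof. by move=> x; apply: sedge_irr. Qed.

Definition induced : sgraph := SGraph induced_edge_sym induced_edge_irr.
End Induced.

(* Boolean, so that it can be used in cardinalities; see isomorphicP. *)
Definition isomorphic (G H : sgraph) : bool :=
  [exists f : {ffun G -> H},
    [&& injectiveb f,
        [forall y, exists x, f x == y] &
        [forall x, forall y, sedge (f x) (f y) == sedge x y]]].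

Lemma isomorphicP (G H : sgraph) :
  reflect (exists2 f : G -> H, bijective f &
             {mono f : x y / sedge x y >-> sedge x y})
          (isomorphic G H).
Proof.
apply: (iffP existsP) => [[f /and3P[/injectiveP injf /forallP surjf /forallP fE]]|].
  exists f; last by move=> x y; apply/eqP; move/forallP: (fE x); apply.
  have surj y : exists x, f x == y by apply/existsP.
  exists (fun y => xchoose (surj y)) => [x|y]; last exact/eqP/(xchooseP (surj y)).
  by apply: injf; apply/eqP/(xchooseP (surj (f x))).
case=> f [g fK gK] fE; exists (finfun f); apply/and3P; split.
- by apply/injectiveP => x y; rewrite !ffunE; apply: can_inj.
- by apply/forallP => y; apply/existsP; exists (g y); rewrite ffunE gK.
- by apply/forallP => x; apply/forallP => y; rewrite !ffunE fE.
Qed.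

(* A multiset of isomorphism classes is represented by its multiplicity
   function: [deck_mult k G H] is the multiplicity of the class of [H] in the
   [k]-deck of [G], where [k] is the number of vertices kept. *)
Definition deck_mult (k : nat) (G H : sgraph) : nat :=
  #|[set S : {set G} | (#|S| == k) && isomorphic (induced S) H]|.

Definition same_deck (k : nat) (F G : sgraph) : Prop :=
  forall H : sgraph, deck_mult k F H = deck_mult k G H.

(* [ucycle] also accepts the empty sequence and [:: x; y] with [x], [y]
   adjacent, which are not graph cycles; hence the bound on the size. *)
Definition acyclic (G : sgraph) : Prop :=
  ~ exists c : seq G, 3 <= size c /\ ucycle (@sedge G) c.

(* The family consists of the [n]-vertex graphs satisfying [P]. *)
Definition recognizable (l n : nat) (P : sgraph -> Prop) : Prop :=
  forall F G : sgraph, #|F| = n -> #|G| = n ->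
    P F -> same_deck (n - l) F G -> P G.

(* Main.v *)
(* Let k = n - l, so n <= 2k - 1, let F be acyclic and suppose that G has a cycle; every cycle of
   G has more than k vertices, since the k-cards are acyclic.  Call a vertex (resp. an edge) central
   at level D = 2j (resp. 2j + 1) if it is the middle of a path with D edges; its blob is the ball of
   radius j around it.  As long as all blobs of level D have at most k vertices, Moebius inversion
   over the subtrees of a blob shows that the deck determines the multiset of blobs of level D.

   Consecutive levels satisfy an Euler-type relation: (central vertices) - (central edges) is
   positive for F, hence for G, and this forces a component of G that avoids the cycle and contains a
   path with D vertices when levels D - 1 and D fit into cards.  This component leaves so little room
   around the cycle that the blobs of G at level D + 1 also fit.  In F a blob of odd level with more
   than k vertices leaves too few vertices outside to carry the required number of central vertices;
   at even level it forces a spider with many long legs, which G does not contain often enough,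
   unless (n, l) = (5, 2).  At level k - 1 the extra component no longer fits into G. *)

Require Import Defs.
From mathcomp Require Import all_boot all_order all_algebra zify.

Set Implicit Arguments.
Unset Strict Implicit.
Unset Printing Implicit Defensive.
Import Order.TTheory GRing.Theory Num.Theory.

(** * Sums determined by the deck *)

Section DeckSums.
Local Open Scope ring_scope.

(** A card shows part of a ball without telling whether more of the ball was deleted. Inverting over
    the sets that are their own blobs corrects this, at the price that every blob must fit into a
    card; the size bound is the real obstacle and forces the induction on levels. Blobs of G, and
    those of odd level in F, turn out to have at most n + 1 - k vertices, and n <= 2k - 1 is what
    makes this at most k. At even levels the estimate for F is weaker by the number of long branches
    at the centre. What survives is the borderline k = (e + 3)(i + 1), where e counts the edges of
    level 2i + 1 of G off the cycle: a spider with e + 3 legs of length i + 1 then misses fitting by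
    one vertex. The exception is the case e = 0, i = 0, hence k = 3 and n = 5: a 4-cycle with an
    isolated vertex has the same 3-deck as the claw with one edge subdivided. *)

Definition embeds_on (G H : sgraph) (f : G -> H) (S : {set G}) : Prop :=
  {in S &, injective f} /\ {in S &, {mono f : x y / sedge x y}}.

(** Embeddings are total maps constrained only on [S], so vertex sets of different graphs can be
    compared without passing to subtypes; [induced] is needed only for the cards themselves. *)
Definition iso_invariant (Psi : forall G : sgraph, {set G} -> rat) : Prop :=
  forall (G H : sgraph) (f : G -> H) (S : {set G}),
    embeds_on f S -> Psi H (f @: S) = Psi G S.

Lemma embeds_on_sub (G H : sgraph) (f : G -> H) (A B : {set G}) :
  A \subset B -> embeds_on f B -> embeds_on f A.
Proof.
by move=> /subsetP sAB [fI fE]; split=> x y /sAB xB /sAB yB; [apply: fI | apply: fE].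
Qed.

Lemma isomorphic_refl (G : sgraph) : isomorphic G G.
Proof. by apply/isomorphicP; exists id => //; exists id. Qed.

Lemma isomorphic_sym (G H : sgraph) : isomorphic G H = isomorphic H G.
Proof.
suff imp A B : isomorphic A B -> isomorphic B A by apply/idP/idP; apply: imp.
case/isomorphicP=> f [g fK gK] fE; apply/isomorphicP; exists g; first by exists f.
by move=> x y; rewrite -fE !gK.
Qed.

Lemma isomorphic_trans (G H K : sgraph) :
  isomorphic G H -> isomorphic H K -> isomorphic G K.
Proof.
case/isomorphicP=> f fB fE /isomorphicP[g gB gE]; apply/isomorphicP.
by exists (g \o f); [apply: bij_comp | move=> x y /=; rewrite gE fE].
Qed.

Lemma iso_invariant_induced Psi (G : sgraph) (S : {set G}) :
  iso_invariant Psi -> Psi (induced S) setT = Psi G S.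
Proof.
move=> hPsi; have imS : (fun x : induced S => val x) @: setT = S.
  apply/setP=> x; apply/imsetP/idP => [[y _ ->]|xS]; first exact: (valP y).
  by exists (Sub x xS).
rewrite -[in RHS]imS; symmetry; apply: hPsi; split=> [x y _ _|x y _ _] //; exact: val_inj.
Qed.

Lemma iso_invariant_iso Psi (G H : sgraph) (S : {set G}) (S' : {set H}) :
  iso_invariant Psi -> isomorphic (induced S) (induced S') -> Psi G S = Psi H S'.
Proof.
move=> hPsi /isomorphicP[f fB fE].
rewrite -(iso_invariant_induced S hPsi) -(iso_invariant_induced S' hPsi).
have imf : f @: setT = setT.
  by case: fB => g fK gK; apply/setP=> y; rewrite inE -[y]gK imset_f ?inE.
rewrite -imf; symmetry; apply: hPsi; split=> [x y _ _|x y _ _]; [exact: bij_inj | exact: fE].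
Qed.


(** The type of graphs is not finite, so there is no sum over isomorphism classes. Instead each card
    shares its value equally among the isomorphic cards of the other graph, whose number is its
    multiplicity in either deck, and the double sum over isomorphic pairs is exchanged. *)
Lemma deck_sum_eq Psi k (F G : sgraph) :
  iso_invariant Psi -> same_deck k F G ->
  \sum_(K : {set F} | #|K| == k) Psi F K = \sum_(K : {set G} | #|K| == k) Psi G K.
Proof.
move=> hPsi FG.
pose mF (K : {set F}) := (deck_mult k F (induced K))%:R : rat.
pose mG (K : {set G}) := (deck_mult k G (induced K))%:R : rat.
have mF0 (K : {set F}) : #|K| == k -> mF K != 0.
  move=> kK; rewrite pnatr_eq0 -lt0n /deck_mult card_gt0; apply/set0Pn; exists K.
  by rewrite inE kK isomorphic_refl.
have mG0 (K : {set G}) : #|K| == k -> mG K != 0.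
  move=> kK; rewrite pnatr_eq0 -lt0n /deck_mult card_gt0; apply/set0Pn; exists K.
  by rewrite inE kK isomorphic_refl.
have mE (K : {set F}) (K' : {set G}) :
    isomorphic (induced K') (induced K) -> mF K = mG K'.
  move=> KK'; rewrite /mF /mG FG; congr (_%:R).
  apply: eq_card => S; rewrite !inE; congr (_ && _).
  apply/idP/idP => SK; apply: isomorphic_trans SK _ => //.
  by rewrite isomorphic_sym.
transitivity (\sum_(K : {set F} | #|K| == k) \sum_(K' : {set G} | #|K'| == k)
    if isomorphic (induced K') (induced K) then Psi F K / mF K else 0).
  apply: eq_bigr => K kK; rewrite -big_mkcondr sumr_const /=.
  rewrite -[LHS](divfK (mF0 K kK)) {2}/mF FG mulr_natr; congr (_ *+ _).
  by apply: eq_card => S; rewrite !inE.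
rewrite exchange_big /=; apply: eq_bigr => K' kK'.
transitivity (\sum_(K : {set F} | #|K| == k)
    if isomorphic (induced K') (induced K) then Psi G K' / mG K' else 0).
  apply: eq_bigr => K kK; case: ifP => // iso.
  by rewrite (mE _ _ iso) -(iso_invariant_iso hPsi iso).
rewrite -big_mkcondr sumr_const /=.
rewrite -[RHS](divfK (mG0 K' kK')) {3}/mG -FG mulr_natr; congr (_ *+ _).
by apply: eq_card => S; rewrite !inE isomorphic_sym.
Qed.

Lemma card_supersets (T : finType) (S : {set T}) k :
  (#|S| <= k)%N ->
  #|[set K : {set T} | (#|K| == k) && (S \subset K)]| = 'C(#|T| - #|S|, k - #|S|).
Proof.
move=> Sk; have -> : (#|T| - #|S|)%N = #|~: S| by rewrite [RHS]cardsCs setCK.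
rewrite -cards_draws -[RHS](card_in_imset (f := fun K => K :|: S)); last first.
  move=> A B; rewrite !inE => /andP[dA _] /andP[dB _] /(congr1 (fun K => K :&: ~: S)).
  by rewrite !setIUl setICr !setU0 (setIidPl dA) (setIidPl dB).
apply: eq_card => K; rewrite !inE; apply/andP/imsetP => [[/eqP kK SK]|[A]].
  exists (K :\: S); last first.
    apply/setP=> x; rewrite !inE; case: (boolP (x \in S)) => [/(subsetP SK) ->|_].
      by rewrite orbT.
    by rewrite orbF.
  by rewrite inE setDE subsetIr -setDE cardsD (setIidPr SK) kK eqxx.
rewrite inE => /andP[dA /eqP cA] ->; rewrite subsetUr; split=> //.
rewrite cardsU; have -> : A :&: S = set0.
  by apply/eqP; rewrite setI_eq0 disjoints_subset.
by rewrite cards0 subn0 cA subnK.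
Qed.

Lemma sum_subsets_imset (G H : sgraph) (f : G -> H) (S : {set G}) (B : {set H} -> rat) :
  {in S &, injective f} ->
  \sum_(A : {set H} | A \subset f @: S) B A = \sum_(A : {set G} | A \subset S) B (f @: A).
Proof.
move=> fI; rewrite (reindex_onto (fun A : {set G} => f @: A) (fun A => S :&: f @^-1: A)) /=.
  apply: eq_bigl => A; apply/andP/idP => [[_ /eqP <-]|AS]; first exact: subsetIl.
  split; first exact: imsetS.
  apply/eqP/setP=> x; rewrite !inE; apply/andP/idP => [[xS /imsetP[y yA fxy]]|xA].
    by rewrite (fI x y) // (subsetP AS).
  by rewrite (subsetP AS) // imset_f.
move=> A /subsetP AfS; apply/setP=> y; apply/imsetP/idP => [[x]|yA].
  by rewrite !inE => /andP[_ fxA] ->.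
by case/imsetP: (AfS y yA) => x xS yE; exists x; rewrite ?inE ?xS -?yE.
Qed.

(** Kelly's counting argument with weights: a set of size [s] lies in ['C(n - s, k - s)] vertex sets
    of cards, so within each card it is charged with the inverse of that number. *)
Lemma small_sum_eq Psi k (F G : sgraph) :
  iso_invariant Psi -> #|F| = #|G| -> (k <= #|F|)%N -> same_deck k F G ->
  \sum_(S : {set F} | (#|S| <= k)%N) Psi F S = \sum_(S : {set G} | (#|S| <= k)%N) Psi G S.
Proof.
move=> hPsi nFG kn FG; set n := #|F|.
pose wt (s : nat) := ('C(n - s, k - s))%:R : rat.
pose Sub (G : sgraph) (K : {set G}) := \sum_(S : {set G} | S \subset K) (Psi G S / wt #|S|).
have SubI : iso_invariant Sub.
  move=> G1 G2 f S fS; have [fI fE] := fS; rewrite /Sub sum_subsets_imset //.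
  apply: eq_bigr => A AS; rewrite hPsi; last exact: embeds_on_sub fS.
  by rewrite card_in_imset // => x y xA yA; apply: fI; apply: (subsetP AS).
have SumSub (H : sgraph) : #|H| = n ->
    \sum_(K : {set H} | #|K| == k) Sub H K = \sum_(S : {set H} | (#|S| <= k)%N) Psi H S.
  move=> Hn; rewrite /Sub (exchange_big_dep xpredT) //= [RHS]big_mkcond /=.
  apply: eq_bigr => S _; case: leqP => Sk; last first.
    rewrite big1 // => K /andP[/eqP kK SK].
    by move: (subset_leq_card SK); rewrite kK leqNgt Sk.
  rewrite sumr_const.
  have -> : #|[pred K : {set H} | (#|K| == k) && (S \subset K)]| = 'C(n - #|S|, k - #|S|).
    by rewrite -Hn -card_supersets //; apply: eq_card => K; rewrite !inE.
  rewrite -mulr_natr divfK //.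
  rewrite pnatr_eq0 -lt0n bin_gt0; apply: leq_sub2r; exact: kn.
by rewrite -(SumSub F) // -(SumSub G) //; apply: deck_sum_eq.
Qed.

End DeckSums.

(** * Non-backtracking extensions, balls and blobs *)

Section NonBacktracking.
Variables (G : sgraph) (S : {set G}).

(* [i] counts the edges after [u -- v], hence the shift of the index in [core] below. *)
Fixpoint nbext (i : nat) (u v : G) : bool :=
  [&& u \in S, v \in S, sedge u v &
      if i is i'.+1 then [exists w, (w != u) && nbext i' v w] else true].

Definition nbdeg (i : nat) (v : G) : nat := #|[set u | nbext i v u]|.

Definition core (j : nat) (v : G) : bool := if j is i.+1 then 1 < nbdeg i v else v \in S.

Definition ball (j : nat) (Z : {set G}) : {set G} :=
  iter j (fun Y => Y :|: [set y in S | [exists x in Y, sedge x y]]) Z.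

(** Vertices are coded as diagonal pairs and edges as darts, so an edge appears in both
    orientations. Non-backtracking walks stand in for paths: the condition is local, and the two
    notions agree below the length of every cycle. *)
Definition central (D : nat) (x : G * G) : bool :=
  if odd D then nbext D./2 x.1 x.2 && nbext D./2 x.2 x.1
  else (x.1 == x.2) && core D./2 x.1.

Definition blob (D : nat) (x : G * G) : {set G} := ball D./2 [set x.1; x.2].

(** [S] is its own blob, with distances measured inside [S]. The inversion runs over these sets;
    around a given central [x] the largest of them is [blob setT D x]. *)
Definition good (D : nat) (x : G * G) : bool := central D x && (S \subset blob D x).

End NonBacktracking.

Arguments ball : simpl never.

Section Basics.
Variable G : sgraph.
Implicit Types (S A B Z : {set G}) (u v w : G) (x : G * G).

Lemma nbext_mem S i u v : nbext S i u v -> [/\ u \in S, v \in S & sedge u v].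
Proof. by case: i => [|i] /= /and4P[-> -> ->]. Qed.

Lemma nbextS S i u v :
  nbext S i.+1 u v =
  [&& u \in S, v \in S, sedge u v & [exists w, (w != u) && nbext S i v w]].
Proof. by []. Qed.

Lemma nbext_sub A B i u v : A \subset B -> nbext A i u v -> nbext B i u v.
Proof.
move=> /subsetP AB; elim: i u v => [|i IH] u v.
  by rewrite /= !andbT => /and3P[/AB-> /AB-> ->].
rewrite !nbextS => /and4P[/AB-> /AB-> -> /existsP[w /andP[wu /IH vw]]] /=.
by apply/existsP; exists w; rewrite wu.
Qed.

Lemma nbext_pred S i u v : nbext S i.+1 u v -> nbext S i u v.
Proof.
elim: i u v => [|i IH] u v; first by rewrite nbextS /= => /and4P[-> -> ->].
rewrite !nbextS => /and4P[-> -> -> /existsP[w /andP[wu /IH vw]]] /=.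
by apply/existsP; exists w; rewrite wu.
Qed.

Lemma nbdeg_sub A B i v : A \subset B -> nbdeg A i v <= nbdeg B i v.
Proof.
by move=> AB; apply/subset_leq_card/subsetP => u; rewrite !inE; apply: nbext_sub.
Qed.

Lemma core_mem S j v : core S j v -> v \in S.
Proof.
case: j => [|i] //= /ltnW; rewrite card_gt0 => /set0Pn[u].
by rewrite inE => /nbext_mem[].
Qed.

Lemma core_sub A B j v : A \subset B -> core A j v -> core B j v.
Proof.
case: j => [|i] AB /=; first exact: (subsetP AB).
by move=> /leq_trans; apply; apply: nbdeg_sub.
Qed.

Lemma central_sub A B D x : A \subset B -> central A D x -> central B D x.
Proof.
rewrite /central; case: ifP => _ AB /andP[h1 h2].
  by rewrite !(nbext_sub AB).
by rewrite h1 (core_sub AB).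
Qed.

Lemma central_mem S D x : central S D x -> (x.1 \in S) /\ (x.2 \in S).
Proof.
rewrite /central; case: ifP => _ /andP[]; first by move=> /nbext_mem[].
by move=> /eqP <- /core_mem.
Qed.

Lemma ballS S j Z :
  ball S j.+1 Z = ball S j Z :|: [set y in S | [exists x in ball S j Z, sedge x y]].
Proof. by []. Qed.

Lemma ball_incr S j Z : ball S j Z \subset ball S j.+1 Z.
Proof. by rewrite ballS subsetUl. Qed.

Lemma ball_le S i j Z : i <= j -> ball S i Z \subset ball S j Z.
Proof.
move=> /subnK <-; elim: (j - i) => [|m IH]; first by rewrite add0n.
by rewrite addSn; apply: subset_trans IH (ball_incr _ _ _).
Qed.

Lemma ball_sub A B j Z : A \subset B -> ball A j Z \subset ball B j Z.
Proof.
move=> AB; elim: j => [|j IH] //; rewrite !ballS; apply: setUSS => //.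
apply/subsetP => y; rewrite !inE => /andP[/(subsetP AB)-> /existsP[x /andP[xb xy]]] /=.
by apply/existsP; exists x; rewrite (subsetP IH).
Qed.

Lemma ball_subset S j Z : Z \subset S -> ball S j Z \subset S.
Proof.
move=> ZS; elim: j => [|j IH] //; rewrite ballS subUset IH /=.
by apply/subsetP => y; rewrite inE => /andP[].
Qed.

Lemma ball_step S j Z u v :
  u \in ball S j Z -> v \in S -> sedge u v -> v \in ball S j.+1 Z.
Proof.
move=> uB vS uv; rewrite ballS !inE vS; apply/orP; right.
by apply/existsP; exists u; rewrite uB.
Qed.

Lemma ball_idem j Z : ball (ball setT j Z) j Z = ball setT j Z.
Proof.
apply/eqP; rewrite eqEsubset ball_sub ?subsetT //=.
suff H i : i <= j -> ball setT i Z \subset ball (ball setT j Z) i Z by apply: H.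
elim: i => [|i IH] ij //; apply/subsetP => y; rewrite !ballS => /setUP[yB|].
  by rewrite inE (subsetP (IH (ltnW ij))).
rewrite !inE /= => /existsP[x /andP[xB xy]]; apply/orP; right; apply/andP; split.
  by apply: (subsetP (ball_le setT Z ij)); apply: ball_step xB _ xy; rewrite inE.
by apply/existsP; exists x; rewrite (subsetP (IH (ltnW ij))).
Qed.

(** Each edge increases the distance to [Z] by at most one, and index [i] stands for [i + 1] edges,
    whence the strict inequality. *)
Lemma nbext_ball j Z a i u v :
  a + i < j -> u \in ball setT a Z -> nbext setT i u v -> nbext (ball setT j Z) i u v.
Proof.
elim: i a u v => [|i IH] a u v aj uB.
  rewrite /= !inE !andbT => /= uv; rewrite uv andbT.
  rewrite (subsetP (ball_le setT Z _) _ uB); last by lia.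
  by rewrite (subsetP (ball_le setT Z _) v (ball_step uB _ uv)) ?inE //; lia.
rewrite !nbextS => /and4P[_ _ uv /existsP[w /andP[wu vw]]].
have vB : v \in ball setT a.+1 Z by apply: ball_step uB _ uv; rewrite inE.
rewrite uv (subsetP (ball_le setT Z _) _ uB) ?(subsetP (ball_le setT Z _) v vB) /=; try lia.
by apply/existsP; exists w; rewrite wu (IH a.+1) //; lia.
Qed.

Lemma nbdeg_ball i v : nbdeg (ball setT i.+1 [set v]) i v = nbdeg setT i v.
Proof.
apply/eqP; rewrite eqn_leq nbdeg_sub ?subsetT //=; apply/subset_leq_card/subsetP => u.
by rewrite !inE; apply: (@nbext_ball _ _ 0); rewrite // inE.
Qed.

Lemma good_blob D x : central setT D x -> good (blob setT D x) D x.
Proof.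
rewrite /good /blob ball_idem subxx andbT /central; set j := D./2; set Z := [set _; _].
case: ifP => _ /andP[]; last first.
  rewrite /Z => /eqP<-; rewrite setUid eqxx /=; case: j => [|i] /=; rewrite ?inE //.
  by rewrite nbdeg_ball.
have Zj : Z \subset ball setT j Z by apply: (ball_le setT Z (leq0n j)).
have edge u v : u \in Z -> v \in Z -> nbext setT j u v -> nbext (ball setT j Z) j u v.
  case: j Zj => [|i] /subsetP Zj uZ vZ.
    by move=> /nbext_mem[_ _ uv]; rewrite /= uv !andbT; apply/andP; split; apply: Zj.
  rewrite !nbextS => /and4P[_ _ -> /existsP[w /andP[wu vw]]].
  rewrite (Zj u) // (Zj v) //=; apply/existsP; exists w.
  by rewrite wu; apply: (@nbext_ball _ _ 0).
by move=> h1 h2; rewrite !edge ?h1 ?h2 // !inE eqxx ?orbT.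
Qed.

Lemma good_sub_blob S D x : good S D x -> S \subset blob setT D x.
Proof. by case/andP=> _ /subset_trans; apply; apply/ball_sub/subsetT. Qed.

End Basics.

(** * Invariance under embeddings *)

Section Embedding.
Variables (G H : sgraph) (f : G -> H) (S : {set G}).
Hypothesis fS : embeds_on f S.

Let fI : {in S &, injective f}. Proof. by case: fS. Qed.
Let fE : {in S &, {mono f : x y / sedge x y}}. Proof. by case: fS. Qed.

Lemma mem_imset_emb (A : {set G}) u : A \subset S -> u \in S -> (f u \in f @: A) = (u \in A).
Proof.
move=> /subsetP AS uS; apply/imsetP/idP => [[v vA fuv]|uA]; last by exists u.
by rewrite (fI uS (AS v vA) fuv).
Qed.

Lemma nbext_emb i u v :
  u \in S -> v \in S -> nbext (f @: S) i (f u) (f v) = nbext S i u v.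
Proof.
elim: i u v => [|i IH] u v uS vS.
  by rewrite /= !imset_f // uS vS fE.
rewrite !nbextS !imset_f // uS vS fE //; do 3 congr andb.
apply/existsP/existsP => [[w' /andP[w'u vw]]|[w /andP[wu vw]]].
  have [_ /imsetP[w wS wE] _] := nbext_mem vw; exists w.
  by rewrite -IH // -wE vw andbT; apply: contraNneq w'u => <-; rewrite wE.
have [_ wS _] := nbext_mem vw; exists (f w); rewrite IH // vw andbT.
by apply: contraNneq wu => /(fI wS uS)->.
Qed.

Lemma nbdeg_emb i v : v \in S -> nbdeg (f @: S) i (f v) = nbdeg S i v.
Proof.
move=> vS; rewrite /nbdeg -[RHS](card_in_imset (f := f)); last first.
  by move=> x y; rewrite !inE => /nbext_mem[_ xS _] /nbext_mem[_ yS _]; apply: fI.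
apply: eq_card => y; rewrite inE; apply/idP/imsetP => [vy|[u]].
  have [_ /imsetP[u uS uE] _] := nbext_mem vy; exists u => //.
  by rewrite inE -nbext_emb // -uE.
by rewrite inE => vu ->; rewrite nbext_emb //; case: (nbext_mem vu).
Qed.

Lemma ball_emb j (Z : {set G}) : Z \subset S -> ball (f @: S) j (f @: Z) = f @: ball S j Z.
Proof.
move=> ZS; elim: j => [|j IH] //; rewrite !ballS imsetU IH; congr (_ :|: _); apply/setP=> y.
rewrite inE; apply/andP/imsetP => [[/imsetP[u uS ->] /existsP[x' /andP[]]]|[u]].
  move=> /imsetP[x xB ->]; have xS := subsetP (ball_subset j ZS) x xB; rewrite fE // => xu.
  by exists u => //; rewrite inE uS; apply/existsP; exists x; rewrite xB.
rewrite inE => /andP[uS /existsP[x /andP[xB xu]]] ->; rewrite imset_f //; split=> //.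
by apply/existsP; exists (f x); rewrite imset_f // fE // (subsetP (ball_subset j ZS)).
Qed.

Lemma core_emb j v : v \in S -> core (f @: S) j (f v) = core S j v.
Proof. by case: j => [|i] vS /=; rewrite ?nbdeg_emb // imset_f. Qed.

Lemma good_emb D u v : u \in S -> v \in S -> good (f @: S) D (f u, f v) = good S D (u, v).
Proof.
move=> uS vS; rewrite /good /central /blob /= !nbext_emb // core_emb //.
rewrite (inj_in_eq fI) //; congr andb.
have -> : [set f u; f v] = f @: [set u; v] by rewrite imsetU !imset_set1.
have ZS : [set u; v] \subset S by apply/subsetP => x /set2P[]->.
rewrite ball_emb //; apply/subsetP/subsetP => sub y.
  move=> yS; have := sub (f y) (imset_f f yS).
  by rewrite mem_imset_emb // ball_subset.
by case/imsetP=> x xS ->; rewrite imset_f // sub.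
Qed.

End Embedding.

(** * Moebius inversion over blobs *)

Section BlobSums.
Local Open Scope ring_scope.


Definition pair_invariant (phi : forall G : sgraph, {set G} -> G * G -> rat) : Prop :=
  forall (G H : sgraph) (f : G -> H) (S : {set G}) (u v : G),
    embeds_on f S -> u \in S -> v \in S -> phi H (f @: S) (f u, f v) = phi G S (u, v).

Lemma pair_invariant_sum phi :
  pair_invariant phi ->
  iso_invariant (fun (G : sgraph) (S : {set G}) =>
    \sum_(x : G * G | (x.1 \in S) && (x.2 \in S)) phi G S x).
Proof.
move=> hphi G H f S fS; have [fI _] := fS.
pose F (x : G * G) := (f x.1, f x.2).
transitivity (\sum_(y in F @: [set x | (x.1 \in S) && (x.2 \in S)]) phi H (f @: S) y).
  apply: eq_bigl => -[y1 y2] /=; apply/andP/imsetP => [[]|[[x1 x2]]].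
    move=> /imsetP[x1 x1S ->] /imsetP[x2 x2S ->]; exists (x1, x2) => //.
    by rewrite inE /= x1S x2S.
  by rewrite inE /= => /andP[x1S x2S] [-> ->]; rewrite !imset_f.
rewrite big_imset /=; last first.
  move=> [x1 x2] [y1 y2]; rewrite !inE /= => /andP[x1S x2S] /andP[y1S y2S] [e1 e2].
  by rewrite (fI _ _ x1S y1S e1) (fI _ _ x2S y2S e2).
apply: eq_big => [x|[u v]]; rewrite inE //= => /andP[uS vS].
by rewrite /F /= hphi.
Qed.

Section Moebius.
Variables (D : nat) (phi : forall G : sgraph, {set G} -> G * G -> rat).
Hypothesis hphi : pair_invariant phi.

Fixpoint mu_rec (n : nat) (G : sgraph) (S : {set G}) (x : G * G) : rat :=
  if n is n'.+1 then
    phi S x - \sum_(A : {set G} | (A \proper S) && good A D x) mu_rec n' A x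
  else 0.

Definition mu (G : sgraph) (S : {set G}) (x : G * G) : rat := mu_rec #|S|.+1 S x.

Lemma mu_rec_fuel n m (G : sgraph) (S : {set G}) x :
  (#|S| < n)%N -> (#|S| < m)%N -> mu_rec n S x = mu_rec m S x.
Proof.
elim: n m S => [|n IH] [|m] S //= Sn Sm; congr (_ - _).
by apply: eq_bigr => A /andP[/proper_card AS _]; apply: IH; lia.
Qed.

Lemma sum_mu (G : sgraph) (S : {set G}) x :
  good S D x -> \sum_(A : {set G} | (A \subset S) && good A D x) mu A x = phi S x.
Proof.
move=> gS; rewrite (bigD1 S) ?subxx //= {1}/mu /=.
rewrite [X in _ + X](eq_bigl (fun A : {set G} => (A \proper S) && good A D x)); last first.
  by move=> A; rewrite properEneq; case: (A != S); rewrite /= ?andbF ?andbT.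
rewrite [X in _ + X](eq_bigr (fun A => mu_rec #|S| A x)) ?subrK // => A /andP[/proper_card AS _].
by apply: mu_rec_fuel.
Qed.

Lemma good_mem (G : sgraph) (S : {set G}) x : good S D x -> (x.1 \in S) && (x.2 \in S).
Proof. by case/andP => /central_mem[-> ->]. Qed.

Lemma mu_invariant : pair_invariant mu.
Proof.
move=> G H f S u v fS uS vS; have [fI _] := fS.
rewrite /mu (card_in_imset fI); move: (succn #|S|) => N; 
elim: N S fS fI uS vS => [|n IH] {}S fS fI uS vS //=.
rewrite hphi //; congr (_ - _).
transitivity (\sum_(A : {set H} | A \subset f @: S)
    if (A \proper f @: S) && good A D (f u, f v) then mu_rec n A (f u, f v) else 0).
  rewrite -big_mkcondr; apply: eq_bigl => A.
  by case: (boolP (A \proper _)) => [/proper_sub->|]; rewrite /= ?andbF.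
rewrite sum_subsets_imset // [RHS](eq_bigl
    (fun A : {set G} => (A \subset S) && ((A \proper S) && good A D (u, v)))); last first.
  by move=> A; case: (boolP (A \proper _)) => [/proper_sub->|]; rewrite /= ?andbF.
rewrite [RHS]big_mkcondr; apply: eq_bigr => A AS.
have fA := embeds_on_sub AS fS; have [fAI _] := fA.
have -> : (f @: A \proper f @: S) = (A \proper S).
  by rewrite !properEcard imsetS // AS !card_in_imset.
have [|/negP uvA] := boolP ((u \in A) && (v \in A)).
  by move=> /andP[uA vA]; rewrite good_emb // IH.
have /negbTE-> : ~~ good A D (u, v) by apply/negP => /good_mem.
rewrite andbF.
case: ifP => // /andP[_ /good_mem /=].
by rewrite !(mem_imset_emb fS).
Qed.

(** For a fixed centre, all good sets lie inside its blob, so their values of [mu] add up to [phi]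
    of the blob. The hypotheses on blob sizes ensure that the sum over sets of at most [k] vertices
    misses none of them. *)
Lemma central_sum_eq k (F G : sgraph) :
  #|F| = #|G| -> (k <= #|F|)%N -> same_deck k F G ->
  (forall x : F * F, central setT D x -> (#|blob setT D x| <= k)%N) ->
  (forall x : G * G, central setT D x -> (#|blob setT D x| <= k)%N) ->
  \sum_(x : F * F | central setT D x) phi (blob setT D x) x =
  \sum_(x : G * G | central setT D x) phi (blob setT D x) x.
Proof.
move=> nFG kn FG fitF fitG.
pose psi (G : sgraph) (S : {set G}) (x : G * G) := if good S D x then mu S x else 0.
have psiI : pair_invariant psi.
  by move=> G1 G2 f S u v fS uS vS; rewrite /psi good_emb // mu_invariant.
have Sum (H : sgraph) :
    (forall x : H * H, central setT D x -> (#|blob setT D x| <= k)%N) ->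
    \sum_(S : {set H} | (#|S| <= k)%N) \sum_(x : H * H | (x.1 \in S) && (x.2 \in S)) psi H S x
    = \sum_(x : H * H | central setT D x) phi (blob setT D x) x.
  move=> fit; rewrite (exchange_big_dep xpredT) //= [RHS]big_mkcond /=.
  apply: eq_bigr => x _; rewrite -big_mkcondr /=.
  case: ifP => [cx|ncx]; last first.
    rewrite big1 // => S /andP[_ /andP[cS _]].
    by rewrite (central_sub (subsetT S) cS) in ncx.
  rewrite -sum_mu; last exact: good_blob.
  apply: eq_bigl => S; case: (boolP (good S D x)) => gS; rewrite ?andbF // !andbT.
  rewrite good_mem // andbT good_sub_blob //.
  exact: leq_trans (subset_leq_card (good_sub_blob gS)) (fit x cx).
by rewrite -!Sum //; apply: (small_sum_eq (pair_invariant_sum psiI)).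
Qed.

End Moebius.

Definition fits (D k : nat) (G : sgraph) : Prop :=
  forall x : G * G, central setT D x -> (#|blob setT D x| <= k)%N.

(** Counting occurrences of a pattern on at most [k] vertices takes no inversion, hence no bound on
    blobs. This version serves for spiders and short cycles. *)
Lemma count_good_eq (Q : forall G : sgraph, {set G} -> G * G -> bool) k (F G : sgraph) :
  #|F| = #|G| -> (k <= #|F|)%N -> same_deck k F G ->
  (forall (G H : sgraph) (f : G -> H) (S : {set G}) (u v : G),
    embeds_on f S -> u \in S -> v \in S -> Q H (f @: S) (f u, f v) = Q G S (u, v)) ->
  #|[set y : {set F} * (F * F) |
      [&& (#|y.1| <= k)%N, y.2.1 \in y.1, y.2.2 \in y.1 & Q F y.1 y.2]]| =
  #|[set y : {set G} * (G * G) |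
      [&& (#|y.1| <= k)%N, y.2.1 \in y.1, y.2.2 \in y.1 & Q G y.1 y.2]]|.
Proof.
move=> nFG kn FG QI.
have QI' : pair_invariant (fun (G : sgraph) (S : {set G}) (x : G * G) => (Q G S x)%:R).
  by move=> G1 G2 f S u v fS uS vS; rewrite QI.
have E (H : sgraph) : \sum_(S : {set H} | (#|S| <= k)%N)
    \sum_(x : H * H | (x.1 \in S) && (x.2 \in S)) (Q H S x)%:R =
    #|[set y : {set H} * (H * H) |
      [&& (#|y.1| <= k)%N, y.2.1 \in y.1, y.2.2 \in y.1 & Q H y.1 y.2]]|%:R :> rat.
  rewrite pair_big_dep /= -sumr_const [RHS]big_mkcond [LHS]big_mkcond /=.
  apply: eq_bigr => -[S x] _; rewrite !inE /=.
  by case: (#|S| <= k)%N; case: (x.1 \in S); case: (x.2 \in S); case: (Q H S x).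
apply/eqP; rewrite -(eqr_nat rat) -!E; apply/eqP.
exact: (small_sum_eq (pair_invariant_sum QI')).
Qed.

Section Counts.
Variables (k : nat) (F G : sgraph).
Hypotheses (nFG : #|F| = #|G|) (kn : (k <= #|F|)%N) (FG : same_deck k F G).

Lemma card_central_eq D :
  fits D k F -> fits D k G ->
  #|[set x : F * F | central setT D x]| = #|[set x : G * G | central setT D x]|.
Proof.
move=> fF fG; apply/eqP; rewrite -(eqr_nat rat) -!sumr_const.
have := @central_sum_eq D (fun _ _ _ => 1) _ k F G nFG kn FG fF fG.
move=> /(_ (fun _ _ _ _ _ _ _ _ _ => erefl)) E; apply/eqP.
by under eq_bigl do rewrite inE; under [RHS]eq_bigl do rewrite inE.
Qed.

Lemma card_core_eq j :
  fits j.*2 k F -> fits j.*2 k G ->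
  #|[set v : F | core setT j v]| = #|[set v : G | core setT j v]|.
Proof.
move=> fF fG; have := card_central_eq fF fG.
have E (H : sgraph) : #|[set x : H * H | central setT j.*2 x]| = #|[set v : H | core setT j v]|.
  rewrite -[RHS](card_imset _ (f := fun v => (v, v))); last by move=> u v [].
  apply: eq_card => -[u v]; rewrite inE /central odd_double doubleK /=.
  apply/andP/imsetP => [[/eqP<- uC]|[w]]; first by exists u; rewrite ?inE.
  by rewrite inE => wC [-> ->].
by rewrite !E.
Qed.

Lemma sum_nbdeg_eq i :
  fits i.+1.*2 k F -> fits i.+1.*2 k G ->
  (\sum_(v : F | core setT i.+1 v) nbdeg setT i v =
   \sum_(v : G | core setT i.+1 v) nbdeg setT i v)%N.
Proof.
move=> fF fG; apply/eqP; rewrite -(eqr_nat rat); apply/eqP.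
have := @central_sum_eq i.+1.*2
  (fun (G : sgraph) (S : {set G}) (x : G * G) => (nbdeg S i x.1)%:R) _ k F G nFG kn FG fF fG.
have inv : pair_invariant (fun (G : sgraph) (S : {set G}) (x : G * G) => (nbdeg S i x.1)%:R).
  by move=> G1 G2 f S u v fS uS vS /=; rewrite nbdeg_emb.
move=> /(_ inv).
have E (H : sgraph) : \sum_(x : H * H | central setT i.+1.*2 x)
    (nbdeg (blob setT i.+1.*2 x) i x.1)%:R =
    (\sum_(v : H | core setT i.+1 v) nbdeg setT i v)%N%:R :> rat.
  rewrite natr_sum.
  transitivity (\sum_(x in [set (v, v) | v in [set v : H | core setT i.+1 v]])
     (nbdeg setT i x.1)%:R : rat).
    apply: eq_big => [[u v]|[u v]]; rewrite /central odd_double doubleK.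
      apply/andP/imsetP => [[/eqP/= <- uC]|[w]]; first by exists u; rewrite ?inE.
      by rewrite inE => wC [-> ->].
    by case/andP => /= /eqP<- _; rewrite /blob doubleK setUid nbdeg_ball.
  rewrite big_imset /=; last by move=> u v _ _ [].
  by apply: eq_bigl => v; rewrite inE.
by rewrite !E.
Qed.

End Counts.

End BlobSums.

(** * Non-backtracking walks *)

Section Walks.
Variable G : sgraph.
Implicit Types (S X Z : {set G}) (u v w : G) (x y : nat -> G).

Definition walk x (m : nat) : Prop := forall i, i < m -> sedge (x i) (x i.+1).

Definition nbwalk x (m : nat) : Prop := walk x m /\ forall i, i.+1 < m -> x i != x i.+2.

(** Acyclic graphs satisfy this for every [L], so the same lemmas on walks apply to F and to G. *)
Definition girth_gt (L : nat) : Prop :=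
  forall c : seq G, 3 <= size c -> ucycle (@sedge G) c -> L < size c.

Definition catw x (m : nat) y : nat -> G := fun i => if i <= m then x i else y (i - m).

Lemma nbwalk_shift x m a n : nbwalk x m -> a + n <= m -> nbwalk (fun i => x (a + i)) n.
Proof.
move=> [xE xN] an; split=> i ilt; first by rewrite addnS; apply: xE; lia.
by rewrite !addnS; apply: xN; lia.
Qed.

Lemma nbwalk_take x m n : nbwalk x m -> n <= m -> nbwalk x n.
Proof. by move=> xw nm; apply: (nbwalk_shift (a := 0) xw). Qed.

Lemma nbwalk_rev x m : nbwalk x m -> nbwalk (fun i => x (m - i)) m.
Proof.
move=> [xE xN]; split=> i ilt.
  rewrite sedge_sym; have -> : m - i = (m - i.+1).+1 by lia.
  by apply: xE; lia.
rewrite eq_sym; have -> : m - i = (m - i.+2).+2 by lia.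
by apply: xN; lia.
Qed.

Lemma nbwalk_cat x m y n :
  nbwalk x m -> nbwalk y n -> x m = y 0 -> (0 < m -> 0 < n -> x m.-1 != y 1) ->
  nbwalk (catw x m y) (m + n).
Proof.
move=> [xE xN] [yE yN] xy xyN; rewrite /catw; split=> i ilt.
  have [im|mi] := ltnP i m; first by rewrite ltnW // xE.
  have [->|im] := eqVneq i m; first by rewrite leqnn subSnn xy yE //; lia.
  have -> : (i <= m) = false by lia.
  have -> : i.+1 - m = (i - m).+1 by lia.
  by apply: yE; lia.
have [im|mi] := ltnP i.+1 m; first by rewrite (_ : i <= m) ?xN //; lia.
have [im|im] := eqVneq i.+1 m.
  rewrite -im leqnSn (_ : i.+2 - i.+1 = 1); last lia.
  have := xyN; rewrite -im /=; apply => //; lia.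
have [->|im'] := eqVneq i m.
  by rewrite leqnn (_ : m.+2 - m = 2) ?xy ?yN //; lia.
rewrite (_ : (i <= m) = false); last lia.
have -> : i.+2 - m = (i - m).+2 by lia.
by apply: yN; lia.
Qed.

Lemma catw_last x m y n : x m = y 0 -> catw x m y (m + n) = y n.
Proof.
move=> xy; rewrite /catw; case: n => [|n]; first by rewrite addn0 leqnn.
rewrite (_ : (_ <= m) = false); last lia.
by congr y; lia.
Qed.

(** An inner repetition would cut out a shorter closed non-backtracking walk, excluded by induction.
    Without one the walk is a cycle, with at least 3 edges by irreflexivity and non-backtracking. *)
Lemma nbwalk_closed L x m : girth_gt L -> nbwalk x m -> 0 < m <= L -> x 0 != x m.
Proof.
move=> gL; elim/ltn_ind: m x => m IH x xw /andP[m0 mL].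
apply/eqP => x0m; have [xE xN] := xw.
have inj a b : a < b <= m -> (a, b) != (0, m) -> x a != x b.
  move=> /andP[ab bm] abN; have bam : b - a < m.
    by move: abN; rewrite xpair_eqE; lia.
  have := IH (b - a) bam (fun i => x (a + i)) (nbwalk_shift xw _).
  by rewrite addn0 subnKC; [apply; lia | lia].
have := gL (mkseq x m); rewrite size_mkseq => H.
have m3 : 3 <= m.
  case: m m0 {mL IH xw xN inj H} x0m xE (xN) => [|[|[|m]]] // _ x0m xE xN.
    by have := xE 0 isT; rewrite -x0m sedge_irr.
  by have := xN 0 isT; rewrite -x0m eqxx.
have /(H m3) : ucycle (@sedge G) (mkseq x m); last by lia.
apply/andP; split.
  have -> : mkseq x m = x 0 :: [seq x i | i <- iota 1 m.-1] by case: m m0 {mL IH xw x0m xE xN inj H m3}.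
  rewrite /= x0m -map_rcons (_ : rcons (iota 1 m.-1) m = iota 1 m); last first.
    by case: m m0 {mL IH xw x0m xE xN inj H m3} => // m _; rewrite -cats1 -[m.+1 in RHS]addn1 iotaD add1n.
  apply/(pathP (x 0)) => i; rewrite size_map size_iota => im.
  rewrite (nth_map 0) ?size_iota // nth_iota //; case: i im => [|i] im /=.
    by rewrite -x0m xE.
  by rewrite (nth_map 0) ?size_iota 1?ltnW // nth_iota 1?ltnW // xE.
rewrite map_inj_in_uniq ?iota_uniq // => a b; rewrite !mem_iota !add0n => /andP[_ am] /andP[_ bm] xab.
apply/eqP; have [ab|ba|//] := ltngtP a b.
  by have := inj a b; rewrite xab eqxx xpair_eqE; lia.
by have := inj b a; rewrite xab eqxx xpair_eqE; lia.
Qed.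

Lemma nbwalk_inj L x m i j :
  girth_gt L -> nbwalk x m -> m <= L -> i < j <= m -> x i != x j.
Proof.
move=> gL xw mL /andP[ij jm]; have ijm : i + (j - i) <= m by lia.
have := nbwalk_closed gL (nbwalk_shift xw ijm).
by rewrite addn0 (_ : i + (j - i) = j); [apply; lia | lia].
Qed.

(** Once the common beginning is removed, the reverse of one walk followed by the other is a closed
    non-backtracking walk with at most [L] edges. *)
Lemma nbwalk_unique L x m y n :
  girth_gt L -> nbwalk x m -> nbwalk y n -> m + n <= L -> x 0 = y 0 -> x m = y n ->
  m = n /\ forall i, i <= m -> x i = y i.
Proof.
move=> gL; elim: m n x y => [|m IH] [|n] x y xw yw mn xy0 xyl.
- by split=> // i; rewrite leqn0 => /eqP->.
- by have := nbwalk_closed gL yw; rewrite -xy0 -xyl eqxx; move=> /(_ _)/negP []; lia.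
- by have := nbwalk_closed gL xw; rewrite xy0 -xyl eqxx; move=> /(_ _)/negP []; lia.
have [xy1|xy1] := eqVneq (x 1) (y 1).
  have [|||||mn' xy] := IH n (fun i => x i.+1) (fun i => y i.+1).
  - exact: (nbwalk_shift (a := 1) xw).
  - exact: (nbwalk_shift (a := 1) yw).
  - by lia.
  - by [].
  - by [].
  by rewrite mn'; split=> // -[|i] // im; apply: xy; lia.
have := nbwalk_cat (nbwalk_rev xw) yw.
rewrite subnn xy0 => /(_ erefl); rewrite (_ : m.+1 - m.+1.-1 = 1) => [|/=]; last lia.
move=> /(_ (fun _ _ => xy1)) /(nbwalk_closed gL).
by rewrite catw_last ?subnn // /catw leq0n subn0 xyl eqxx; move=> /(_ _)/negP []; lia.
Qed.

Lemma nbext_walk S i u v :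
  nbext S i u v -> exists x, [/\ nbwalk x i.+1, x 0 = u & x 1 = v].
Proof.
elim: i u v => [|i IH] u v.
  move=> /nbext_mem[_ _ uv]; exists (fun i => if i is 0 then u else v); split=> //.
  by split=> [[]|[]].
rewrite nbextS => /and4P[_ _ uv /existsP[w /andP[wu /IH[x [[xE xN] x0 x1]]]]].
exists (fun i => if i is i'.+1 then x i' else u); split=> //.
split=> -[|k] // ki; rewrite ?x0 //; [exact: xE| |exact: xN].
by rewrite x1 eq_sym.
Qed.

Lemma walk_nbext S i x :
  nbwalk x i.+1 -> (forall a, a <= i.+1 -> x a \in S) -> nbext S i (x 0) (x 1).
Proof.
elim: i x => [|i IH] x xw xS; have [xE xN] := xw.
  by rewrite /= !xS // xE.
rewrite nbextS !xS // xE //=; apply/existsP; exists (x 2).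
rewrite eq_sym xN //=; apply: (IH (fun i => x i.+1)); last by move=> a ai; apply: xS.
exact: (nbwalk_shift (a := 1) xw).
Qed.

(** The vertex [x a] is at distance exactly [a] from [Z], with distance expressed through membership
    in balls. *)
Definition geodesic Z x m : Prop :=
  [/\ nbwalk x m, x 0 \in Z, forall a, a <= m -> x a \in ball setT a Z &
      forall a b, b < a <= m -> x a \notin ball setT b Z].

Lemma geodesic_ex j Z v :
  v \in ball setT j Z -> exists x m, [/\ geodesic Z x m, m <= j & x m = v].
Proof.
move=> vj; have ex : exists i, v \in ball setT i Z by exists j.
case: (ex_minnP ex) => m vm mmin {ex}.
suff [x [xg xm]] : exists x, geodesic Z x m /\ x m = v.
  by exists x, m; split=> //; apply: mmin.
elim: m v vm mmin {j vj} => [|m IH] v vm mmin.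
  exists (fun=> v); split=> //; split=> // a; last by move=> b; lia.
  by rewrite leqn0 => /eqP->.
have vNm : v \notin ball setT m Z by apply/negP => /mmin; rewrite ltnn.
move: (vm); rewrite ballS in_setU (negbTE vNm) inE in_setT /= => /existsP[u /andP[um uv]].
have [|x [[[xE xN] x0 xB xNB] xm]] := IH u um.
  move=> i ui; rewrite leqNgt; apply/negP => im; case/negP: vNm.
  by apply: (subsetP (ball_le setT Z im)); apply: ball_step ui _ uv; rewrite inE.
have B a : a <= m.+1 -> (if a <= m then x a else v) \in ball setT a Z.
  by have [am|am am'] := leqP a m => [_|]; [exact: xB | have -> : a = m.+1 by lia].
have NB a b : b < a <= m.+1 -> (if a <= m then x a else v) \notin ball setT b Z.
  have [am|am] := leqP a m => /andP[ba ?]; first by apply: xNB; rewrite ba.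
  by apply: contra vNm => /(subsetP (ball_le setT Z _)); apply; lia.
exists (fun i => if i <= m then x i else v); split; last by rewrite ltnn.
split=> //; split=> i im.
  have [im'|im'] := ltnP i m; first by rewrite ltnW // xE.
  by have -> : i = m by [lia]; rewrite leqnn xm.
apply/eqP => E; have /negP[] : (if i.+2 <= m then x i.+2 else v) \notin ball setT i Z.
  by apply: NB; lia.
by rewrite -E; apply: B; lia.
Qed.

Lemma nbwalk_reduce X x m :
  walk x m -> (forall i, i <= m -> x i \in X) ->
  exists y n, [/\ nbwalk y n, n <= m, y 0 = x 0, y n = x m & forall i, i <= n -> y i \in X].
Proof.
elim/ltn_ind: m x => m IH x xE xX.
have [bad|] := boolP [exists i : 'I_m, (i.+1 < m) && (x i == x i.+2)].
  have /existsP[i /andP[im /eqP xi]] := bad.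
  have [|||y [n [yw nm y0 yn yX]]] := IH (m - 2) _ (fun a => if a <= i then x a else x a.+2).
  - by lia.
  - move=> a am; have [ai|ai] := ltnP a i; first by rewrite ltnW // xE //; lia.
    have [->|ai'] := eqVneq a i; first by rewrite leqnn xi xE //; lia.
    by rewrite (_ : (a <= i) = false) ?xE //; lia.
  - by move=> a am; case: ifP => _; apply: xX; lia.
  exists y, n; split=> //; first lia.
  rewrite yn; have -> : (m - 2 <= i) = (m - 2 == i) by lia.
  case: eqP => [mi|_]; last by congr x; lia.
  by rewrite mi xi; congr x; lia.
rewrite negb_exists => /forallP N; exists x, m; split=> //; split=> // i im.
have im' : i < m by lia.
by have := N (Ordinal im'); rewrite /= im.
Qed.

End Walks.

(** * Euler-type relations and counting away from a root *)

Section Cores.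
Variable G : sgraph.
Implicit Types (S X Z W : {set G}) (u v w : G).

Definition cores (i : nat) : {set G} := [set v | core setT i v].
Definition core_darts (i : nat) : {set G * G} := [set x | central setT i.*2.+1 x].
Definition dart_ends (i : nat) : {set G} := [set u | [exists v, (u, v) \in core_darts i]].

Lemma core_dartsE i u v :
  ((u, v) \in core_darts i) = nbext setT i u v && nbext setT i v u.
Proof. by rewrite inE /central /= odd_double uphalf_double. Qed.

Lemma core_darts_sym i u v : ((u, v) \in core_darts i) = ((v, u) \in core_darts i).
Proof. by rewrite !core_dartsE andbC. Qed.

Lemma core_darts_core i u v : (u, v) \in core_darts i -> core setT i u.
Proof.
rewrite core_dartsE; case: i => [|i] /andP[uv vu] /=; first by rewrite inE.
move: vu; rewrite nbextS => /and4P[_ _ _ /existsP[w /andP[wv uw]]].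
apply/card_gt1P; exists v, w; rewrite !inE uw nbext_pred //.
by rewrite eq_sym wv.
Qed.

(** Of two long branches at [u], at least one does not begin with [v]. *)
Lemma core_nbext_back i u v : core setT i u -> sedge u v -> nbext setT i v u.
Proof.
case: i => [|i] uC uv; first by rewrite /= !inE sedge_sym uv.
rewrite nbextS !inE sedge_sym uv /=.
case/card_gt1P: uC => w [w' [wu w'u ww']]; move: wu w'u; rewrite !inE => wu w'u.
apply/existsP; have [wv|wv] := eqVneq w v; last by exists w; rewrite wv.
by exists w'; rewrite w'u -wv eq_sym ww'.
Qed.

Lemma core_pred i u : core setT i.+1 u -> core setT i u.
Proof.
case: i => [|i] /=; first by rewrite inE.
by move=> /leq_trans; apply; apply/subset_leq_card/subsetP => v; rewrite !inE; apply: nbext_pred.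
Qed.

Lemma core_core_darts i u v : core setT i.+1 u -> nbext setT i u v -> (u, v) \in core_darts i.
Proof.
move=> uC uv; rewrite core_dartsE uv; apply: core_nbext_back (core_pred uC) _.
by case: (nbext_mem uv).
Qed.

(* Odd analogue of (central vertices) - (central edges): the sum counts, at each central vertex of
   level [i.+1.*2], the edges of level [i.*2.+1], so the deck determines [#|dart_ends i|]. *)
Lemma card_core_darts i :
  #|core_darts i| + #|cores i.+1| = \sum_(v : G | core setT i.+1 v) nbdeg setT i v + #|dart_ends i|.
Proof.
pose d u := #|[set v | (u, v) \in core_darts i]|.
have -> : #|core_darts i| = \sum_u d u.
  rewrite -sum1_card (eq_bigl (fun x => xpredT x.1 && ((x.1, x.2) \in core_darts i))); last first.
    by case.
  rewrite -(pair_big_dep xpredT (fun u v => (u, v) \in core_darts i) (fun _ _ => 1)) /=.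
  by apply: eq_bigr => u _; rewrite /d -sum1_card; apply: eq_bigl => v; rewrite inE.
have dE u : d u = if core setT i.+1 u then nbdeg setT i u else (u \in dart_ends i).
  case: ifP => uC.
    apply: eq_card => v; rewrite !inE -(in_set (fun x => central _ _ x)).
    apply/idP/idP => [|/(core_core_darts uC) //].
    by rewrite core_dartsE => /andP[].
  (* Outside the core of index [i.+1] at most one long branch leaves [u], so the number of darts at
     [u] is the indicator of [dart_ends]. *)
  have d1 : d u <= 1.
    move: uC => /negbT; rewrite -leqNgt; apply: leq_trans.
    by apply/subset_leq_card/subsetP => v; rewrite inE [in X in _ -> X]inE core_dartsE => /andP[].
  rewrite inE; case: existsP => [[v uv]|N].
    by apply/eqP; rewrite eqn_leq d1 /= card_gt0; apply/set0Pn; exists v; rewrite inE.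
  by apply: eq_card0 => v; rewrite inE; apply/negP => uv; case: N; exists v.
rewrite -sum1_card (eq_bigr _ (fun u _ => dE u)) (bigID (fun u => core setT i.+1 u)) /=.
rewrite (eq_bigr (nbdeg setT i)) => [|u ->//].
rewrite -addnA; congr (_ + _).
rewrite (eq_bigr (fun u => nat_of_bool (u \in dart_ends i))) => [|u /negbTE->//].
rewrite addnC (eq_bigl (fun u => core setT i.+1 u)) => [|u]; last by rewrite inE.
rewrite -[RHS]sum1_card [RHS](bigID (fun u => core setT i.+1 u)) /=; congr (_ + _).
  apply: eq_bigl => u; case: (boolP (1 < nbdeg setT i u)) => [uC|_]; rewrite ?andbF // andbT.
  have /card_gt0P[v] : 0 < nbdeg setT i u by apply: leq_trans uC.
  rewrite inE => uv; rewrite inE; apply/esym/existsP; exists v; exact: core_core_darts.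
rewrite big_mkcond [RHS]big_mkcond; apply: eq_bigr => u _.
by case: (u \in dart_ends i); case: (1 < nbdeg setT i u).
Qed.

Lemma acyclic_girth L : acyclic G -> girth_gt G L.
Proof. by move=> aG c c3 cc; case: aG; exists c. Qed.

(** If every vertex of [W] had two neighbours in [W], a non-backtracking walk could be continued
    there indefinitely; without cycles its vertices are distinct, too many for [G]. *)
Lemma forest_min_degree W :
  acyclic G -> W != set0 -> exists2 v, v \in W & #|[set u in W | sedge v u]| <= 1.
Proof.
move=> aG /set0Pn[v0 v0W]; apply/exists_inP; apply: contraT.
rewrite negb_exists_in => /forall_inP deg2.
have ext i u v : u \in W -> v \in W -> sedge u v -> nbext W i u v.
  elim: i u v => [|i IH] u v uW vW uv; first by rewrite /= uW vW uv.
  rewrite nbextS uW vW uv /=; have := deg2 v vW; rewrite -ltnNge.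
  case/card_gt1P => w [w' [wv w'v ww']]; move: wv w'v; rewrite !inE => /andP[wW vw] /andP[w'W vw'].
  apply/existsP; have [wu|wu] := eqVneq w u; last by exists w; rewrite wu IH.
  by exists w'; rewrite IH // andbT -wu eq_sym ww'.
have [u uW v0u] : exists2 u, u \in W & sedge v0 u.
  have := deg2 v0 v0W; rewrite -ltnNge => /ltnW /card_gt0P[u]; rewrite inE => /andP[uW v0u].
  by exists u.
have [x [xw _ _]] := nbext_walk (ext #|G| _ _ v0W uW v0u).
have inj : injective (fun i : 'I_#|G|.+1 => x i).
  move=> i j xij; apply/val_inj/eqP; have := ltn_ord i; have := ltn_ord j; rewrite !ltnS => jG iG.
  have [ij|ji|//] := ltngtP i j.
    by have := nbwalk_inj (acyclic_girth _ aG) xw (leqnn _) (i := i) (j := j); rewrite xij eqxx; lia.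
  by have := nbwalk_inj (acyclic_girth _ aG) xw (leqnn _) (i := j) (j := i); rewrite xij eqxx; lia.
by have := leq_card _ inj; rewrite card_ord ltnn.
Qed.

(** The edge bound for forests, doubled because darts are counted; a vertex of degree at most one is
    deleted. *)
Lemma forest_darts W :
  acyclic G -> W != set0 ->
  #|[set x : G * G | [&& x.1 \in W, x.2 \in W & sedge x.1 x.2]]| + 2 <= 2 * #|W|.
Proof.
move=> aG; elim: {W}#|W| {-2}W (erefl #|W|) => [|n IH] W Wn W0.
  by rewrite -cards_eq0 Wn in W0.
have [v vW v1] := forest_min_degree aG W0.
pose W' := W :\ v; have W'n : #|W'| = n by have := cardsD1 v W; rewrite vW Wn; case.
pose N := [set u in W | sedge v u].
set P := [set x | _]; pose P' := [set x : G * G | [&& x.1 \in W', x.2 \in W' & sedge x.1 x.2]].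
have PP' : P \subset P' :|: ([set (v, u) | u in N] :|: [set (u, v) | u in N]).
  apply/subsetP => -[a b]; rewrite !inE /= => /and3P[aW bW ab]; rewrite aW bW ab.
  have [av|av] /= := eqVneq a v.
    by rewrite av imset_f ?orbT // inE bW -av ab.
  have [bv|bv] //= := eqVneq b v.
  by apply/orP; right; rewrite bv imset_f ?orbT // inE aW sedge_sym -bv.
have [W'0|W'0] := eqVneq W' set0.
  suff -> : P = set0 by rewrite cards0 Wn; lia.
  apply/setP => -[a b]; rewrite !inE /=; apply/negP => /and3P[aW bW ab].
  have E c : c \in W -> c = v.
    by move=> cW; apply/eqP; have := in_set0 c; rewrite -W'0 !inE cW andbT => /negbFE.
  by rewrite (E _ aW) (E _ bW) sedge_irr in ab.
have := IH W' W'n W'0; rewrite -/P' Wn W'n.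
have := subset_leq_card PP'.
have := (leq_card_setU P' ([set (v, u) | u in N] :|: [set (u, v) | u in N])).1.
have := (leq_card_setU [set (v, u) | u in N] [set (u, v) | u in N]).1.
have : #|[set (v, u) | u in N]| <= #|N| by apply: leq_imset_card.
have : #|[set (u, v) | u in N]| <= #|N| by apply: leq_imset_card.
by move: v1; rewrite -/N; lia.
Qed.

Lemma core_darts_forest i W :
  acyclic G -> W != set0 -> (forall u v, (u, v) \in core_darts i -> u \in W) ->
  #|core_darts i| + 2 <= 2 * #|W|.
Proof.
move=> aG W0 EW; apply: leq_trans (forest_darts aG W0); rewrite leq_add2r.
apply/subset_leq_card/subsetP => -[u v] uv; rewrite inE /= (EW u v) // (EW v u) 1?core_darts_sym //=.
by move: uv; rewrite core_dartsE => /andP[/nbext_mem[]].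
Qed.

Definition reach Z : {set G} := [set u | [exists z in Z, connect (@sedge G) z u]].

Lemma reachP Z u : reflect (exists j, u \in ball setT j Z) (u \in reach Z).
Proof.
rewrite inE; apply: (iffP exists_inP) => [[z zZ /connectP[p pp ->]]|[j]].
  suff H j : z \in ball setT j Z -> last z p \in ball setT (j + size p) Z.
    by exists (0 + size p); apply: H.
  elim: p z pp {zZ} j => [|w p IH] z /=; first by move=> _ j; rewrite addn0.
  move=> /andP[zw pp] j zj; rewrite addnS -addSn; apply: IH => //.
  by apply: ball_step zj _ zw; rewrite inE.
elim: j u => [|j IH] u; first by move=> uZ; exists u.
rewrite ballS => /setUP[/IH //|]; rewrite !inE /= => /exists_inP[w /IH[z zZ zw] wu].
by exists z => //; apply: connect_trans zw (connect1 wu).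
Qed.

Lemma reach_edge Z u v : u \in reach Z -> sedge u v -> v \in reach Z.
Proof.
by move=> /reachP[j uj] uv; apply/reachP; exists j.+1; apply: ball_step uj _ uv; rewrite inE.
Qed.

Lemma reach_ball Z j u : u \in ball setT j Z -> u \in reach Z.
Proof. by move=> uj; apply/reachP; exists j. Qed.

Lemma reach_sub X Z : X \subset reach Z -> reach X \subset reach Z.
Proof.
move=> /subsetP XZ; apply/subsetP => u; rewrite inE => /exists_inP[x xX xu].
have := XZ x xX; rewrite !inE => /exists_inP[z zZ zx].
by apply/exists_inP; exists z => //; apply: connect_trans zx xu.
Qed.

Lemma reach_sym u v : (u \in reach [set v]) = (v \in reach [set u]).
Proof.
have E a b : (a \in reach [set b]) = connect (@sedge G) b a.
  rewrite inE; apply/exists_inP/idP => [[z /set1P->]//|ba].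
  by exists b; rewrite ?inE.
by rewrite !E (sym_connect_sym (@sedge_sym G)).
Qed.

(** The cycle is indexed by all natural numbers with period [p], so that arcs are shifted walks and
    may run around the cycle several times. *)
Definition cyclic_walk (cy : nat -> G) (p : nat) : Prop :=
  [/\ 2 < p, forall i, sedge (cy i) (cy i.+1) &
      forall i j, (cy i == cy j) = (i == j %[mod p])].

Definition cycle_set (cy : nat -> G) (p : nat) : {set G} := [set cy i | i : 'I_p].

Lemma cycle_setP cy p u :
  cyclic_walk cy p -> reflect (exists i, u = cy i) (u \in cycle_set cy p).
Proof.
move=> [p2 _ cyE]; apply: (iffP imsetP) => [[i _ ->]|[i ->]]; first by exists i.
have ip : i %% p < p by rewrite ltn_mod; lia.
by exists (Ordinal ip) => //=; apply/eqP; rewrite cyE modn_mod.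
Qed.

Lemma card_cycle_set cy p : cyclic_walk cy p -> #|cycle_set cy p| = p.
Proof.
move=> [p2 _ cyE]; rewrite card_imset ?card_ord // => i j /eqP.
by rewrite cyE !modn_small // => /eqP/val_inj.
Qed.

Lemma cyclic_walk_of_ucycle (c : seq G) :
  2 < size c -> ucycle (@sedge G) c -> exists cy, cyclic_walk cy (size c).
Proof.
case: c => [|x0 c] // c2 /andP[cc uc]; set s := x0 :: c.
exists (fun i => nth x0 s (i %% size s)).
have m i : i %% size s < size s by rewrite ltn_mod.
split=> // [i|i j]; last by rewrite nth_uniq.
move: cc; rewrite (cycle_path x0) => /(pathP x0) cc.
have [E|E] := eqVneq (i %% size s) (size s).-1.
  rewrite E nth_last -/s; have := cc 0 isT.
  rewrite (_ : i.+1 %% size s = 0); first by [].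
  by rewrite -addn1 -modnDml E addn1 prednK // modnn.
have i1 : (i %% size s).+1 < size s by have := m i; lia.
have := cc (i %% size s).+1 i1.
by have -> : i.+1 %% size s = (i %% size s).+1 by [rewrite -addn1 -modnDml addn1 modn_small]; exact: id.
Qed.

(** On the cycle [nx] moves one step forward, elsewhere one step closer to the cycle. It never turns
    back: off the cycle the distance drops, and on it two steps forward differ from none because
    [p > 2]. *)
Lemma cycle_next cy p :
  cyclic_walk cy p -> exists nx : G -> G,
    [/\ forall u, u \in reach (cycle_set cy p) -> sedge u (nx u),
        forall u, u \in reach (cycle_set cy p) -> nx (nx u) != u &
        forall u, u \in reach (cycle_set cy p) -> nx u \in reach (cycle_set cy p)].
Proof.
move=> cw; have [p2 cyE cyq] := cw; set C := cycle_set cy p.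
pose Nx u w := (exists i, u = cy i /\ w = cy i.+1) \/
  (exists m, [/\ u \in ball setT m.+1 C, u \notin ball setT m C, w \in ball setT m C & sedge u w]).
have ex u : exists w, u \in reach C -> Nx u w.
  have [/reachP[j uj]|] := boolP (u \in reach C); last by exists u.
  elim: j uj => [|j IH].
    by move=> /(cycle_setP _ cw)[i ->]; exists (cy i.+1) => _; left; exists i.
  have [uj|uj] := boolP (u \in ball setT j C); first by move=> _; apply: IH.
  move=> uj1; move: (uj1); rewrite ballS in_setU (negbTE uj) inE in_setT /= => /exists_inP[w wj wu].
  by exists w => _; right; exists j; rewrite sedge_sym wu.
have {ex} [nx nxP] := fin_all_exists ex; exists nx.
have inC i : cy i \in ball setT 0 C by apply/(cycle_setP _ cw); exists i.
have inB m i : cy i \in ball setT m C by apply: (subsetP (ball_le setT C (leq0n m))).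
have edge u : u \in reach C -> sedge u (nx u).
  by move=> /nxP[[i [-> ->]]|[m []]].
have stay u : u \in reach C -> nx u \in reach C.
  by move=> uR; apply: reach_edge (edge u uR).
split=> // u uR; apply/eqP => E; have := nxP u uR; have := nxP _ (stay u uR); rewrite E.
case=> [[i [ui uE]]|[m [um1 um wm _]]] [[j [uj wj]]|[n [un1 un wn _]]].
- have /eqP h1 : i == j.+1 %[mod p] by rewrite -cyq -ui wj.
  have /eqP h2 : i.+1 == j %[mod p] by rewrite -cyq -uE uj.
  have h3 : (i.+1 + 1) %% p = (j + 1) %% p by rewrite -modnDml h2 modnDml.
  have : 2 + i == 0 + i %[mod p].
    by rewrite (_ : 2 + i = i.+1 + 1) ?h3 ?addn1 -?h1 //; lia.
  by rewrite eqn_modDr mod0n modn_small.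
- by move: un; rewrite uE inB.
- by move: um; rewrite wj inB.
have : m < n by rewrite ltnNge; apply/negP => /(ball_le setT C)/subsetP/(_ _ wn); apply/negP.
have : n < m by rewrite ltnNge; apply/negP => /(ball_le setT C)/subsetP/(_ _ wm); apply/negP.
by lia.
Qed.

(* Sending each vertex to the dart pointing towards the cycle is injective. *)
Lemma cycle_core_darts cy p i :
  cyclic_walk cy p ->
  2 * #|[set u in cores i | u \in reach (cycle_set cy p)]| <= #|core_darts i|.
Proof.
move=> /cycle_next[nx [nxE nxN nxR]]; set R := reach _; set W := [set u in _ | _].
(* Iterating [nx] never backtracks, so a dart pointing towards the cycle extends forward to any
   length; only its backward extension relies on the core. *)
have ext j u : u \in R -> nbext setT j u (nx u).
  elim: j u => [|j IH] u uR; first by rewrite /= !inE nxE.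
  rewrite nbextS !inE nxE //=; apply/existsP; exists (nx (nx u)).
  by rewrite nxN // IH // nxR.
have WE u : u \in W -> (u, nx u) \in core_darts i.
  rewrite inE => /andP[]; rewrite inE => uC uR.
  by rewrite core_dartsE ext // core_nbext_back // nxE.
pose A := [set (u, nx u) | u in W]; pose B := [set (nx u, u) | u in W].
have cA : #|A| = #|W| by apply: card_imset => u v [].
have cB : #|B| = #|W| by apply: card_imset => u v [].
have AB : [disjoint A & B].
  rewrite -setI_eq0; apply/eqP/setP => x; rewrite !inE.
  apply/negP => /andP[/imsetP[u uW ->] /imsetP[v _ [uE vE]]].
  by move: uW; rewrite inE => /andP[_ /nxN]; rewrite vE -uE eqxx.
rewrite mul2n -addnn -{1}cA -cB.
have /eqP <- : #|A :|: B| == #|A| + #|B| by rewrite (leq_card_setU A B).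
apply/subset_leq_card; rewrite subUset; apply/andP; split; apply/subsetP => x /imsetP[u uW ->].
  exact: WE.
by rewrite core_darts_sym WE.
Qed.

End Cores.

(** * Vertices far from a root in a forest *)

Section Away.
Variable G : sgraph.
Implicit Types (Z : {set G}) (u v w : G) (x y : nat -> G).
Hypothesis aG : acyclic G.

Definition is_root Z : Prop := {in Z &, forall z z', z = z' \/ sedge z z'}.

Definition leaves_root Z x m : Prop :=
  [/\ nbwalk x m, x 0 \in Z & forall a, 0 < a <= m -> x a \notin Z].

(** Distinct starting points are adjacent. Prepending that edge to [x] gives two walks with the same
    ends, so [y] would pass through [x 0], which lies in [Z]. *)
Lemma leaves_root_unique Z x m y n :
  is_root Z -> leaves_root Z x m -> leaves_root Z y n -> x m = y n ->
  m = n /\ forall i, i <= m -> x i = y i.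
Proof.
move=> rZ [xw x0 xN] [yw y0 yN] xy.
have [E|e0] := rZ _ _ y0 x0.
  by apply: (nbwalk_unique (acyclic_girth (m + n) aG)).
pose x' a := if a is b.+1 then x b else y 0.
have x'w : nbwalk x' m.+1.
  have [xE xN'] := xw; split=> -[|i] //= im; [exact: xE| |exact: xN'].
  by apply: contraTneq y0 => ->; apply: xN; lia.
have [||mn xy'] := nbwalk_unique (acyclic_girth (m.+1 + n) aG) x'w yw (leqnn _) => //.
have := yN 1; rewrite -mn -xy' //= x0 => /(_ isT); exact.
Qed.

Lemma geodesic_leaves_root Z x m : geodesic Z x m -> leaves_root Z x m.
Proof. by case=> xw x0 _ xN; split=> // a am; apply: xN 0 _. Qed.

(** One of two long branches at [x m] avoids the preceding vertex. Following it for [i] steps ends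
    at distance [m + i], because in a forest the walk leaving [Z] for good is determined by its end,
    hence is the geodesic. *)
Lemma extend_away Z x m i :
  is_root Z -> geodesic Z x m -> 0 < m -> core setT i (x m) ->
  exists y, [/\ leaves_root Z y (m + i), forall a, a <= m -> y a = x a &
             y (m + i) \notin ball setT (m + i).-1 Z].
Proof.
move=> rZ xg m0 xC; have [xw x0 _ xNB] := xg.
suff [y [yw yx]] : exists y, nbwalk y (m + i) /\ forall a, a <= m -> y a = x a.
  have yr : leaves_root Z y (m + i).
    split=> // [|a /andP[a0 ami]]; first by rewrite yx.
    have [am|ma] := leqP a m; first by rewrite yx //; apply: (xNB a 0); lia.
    apply/negP => yaZ; have ya := nbwalk_take yw ami.
    have y0Z : y 0 \in Z by rewrite yx.
    have [E|e] := rZ _ _ y0Z yaZ.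
      by have := nbwalk_closed (acyclic_girth a aG) ya; rewrite E eqxx; move=> /(_ _)/negP[]; lia.
    pose z b := if b is 0 then y 0 else y a.
    have zw : nbwalk z 1 by split=> // -[].
    by have [] := nbwalk_unique (acyclic_girth (a + 1) aG) ya zw; rewrite //; lia.
  exists y; split=> //; apply/negP => /geodesic_ex[g [n [/geodesic_leaves_root gr nm gy]]].
  by have [] := leaves_root_unique rZ gr yr gy; lia.
case: i xC => [|i] xC; first by exists x; rewrite addn0.
case/card_gt1P: xC => w [w' [wu w'u ww']]; move: wu w'u; rewrite !inE => wu w'u.
have [v [vN vE]] : exists v, v != x m.-1 /\ nbext setT i (x m) v.
  have [wx|wx] := eqVneq w (x m.-1); last by exists w.
  by exists w'; rewrite -wx eq_sym.
have [y [yw y0 y1]] := nbext_walk vE.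
exists (catw x m y); split; last by move=> a am; rewrite /catw am.
by apply: nbwalk_cat; rewrite // y1 eq_sym.
Qed.

(** Each such core vertex is pushed [i] steps further from [Z], out of the larger ball; components
    missing [Z] stay fixed. The push is injective: the new end determines the walk from [Z], and the
    old vertex sits [i] steps before that end. *)
Lemma card_away Z i j :
  is_root Z -> i <= j ->
  #|[set u in cores G i | u \notin ball setT (j - i) Z]| + #|ball setT j Z| <= #|G|.
Proof.
move=> rZ ij; set A := [set u in _ | _].
suff [f [fI fB]] : exists f : G -> G,
    {in A &, injective f} /\ forall u, u \in A -> f u \notin ball setT j Z.
  rewrite -(card_in_imset fI) -[X in _ <= X](cardsC (ball setT j Z)) addnC leq_add2l.
  by apply/subset_leq_card/subsetP => _ /imsetP[u uA ->]; rewrite inE fB.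
pose P u v := if u \in reach Z then
  v \in reach Z /\ exists y m,
    [/\ leaves_root Z y (m + i), y m = u, y (m + i) = v & v \notin ball setT j Z]
  else v = u.
have ex u : exists v, u \in A -> P u v.
  have [uA|] := boolP (u \in A); last by exists u.
  rewrite /P; have [/reachP[n un]|] := boolP (u \in reach Z); last by exists u.
  have [x [m [xg _ xu]]] := geodesic_ex un.
  move: uA; rewrite !inE -{1}xu => /andP[uC uN].
  have jm : j - i < m.
    rewrite ltnNge; apply: contra uN => mj; apply: (subsetP (ball_le setT Z mj)).
    by case: xg => _ _ xB _; rewrite -xu xB.
  have m0 : 0 < m by lia.
  have [y [yr yx yN]] := extend_away rZ xg m0 uC.
  exists (y (m + i)) => _; split.
    have [[yE _] y0 _] := yr.
    suff H a : a <= m + i -> y a \in reach Z by apply: H.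
    elim: a => [|a IH] am; first by apply: (reach_ball (j := 0)).
    by apply: reach_edge (IH _) (yE _ _); lia.
  exists y, m; split=> //; first by rewrite yx.
  by apply: contra yN; apply/subsetP/ball_le; lia.
have {ex} [f fP] := fin_all_exists ex; exists f; split=> [u v uA vA fuv|u uA].
  have := fP v vA; have := fP u uA; rewrite /P.
  case: (boolP (u \in reach Z)) => uR; case: (boolP (v \in reach Z)) => vR.
  - move=> [_ [y [m [yr yu yf _]]]] [_ [z [n [zr zv zf _]]]].
    have [|mn yz] := leaves_root_unique rZ yr zr; first by rewrite yf zf.
    by rewrite -yu -zv yz; [congr z; lia | lia].
  - by move=> [fR _] fv; move: fR; rewrite fuv fv (negbTE vR).
  - by move=> fu [fR _]; move: fR; rewrite -fuv fu (negbTE uR).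
  - by move=> <- <-.
have := fP u uA; rewrite /P; case: (boolP (u \in reach Z)) => uR; first by move=> [_ [y [m []]]].
by move=> ->; apply: contra uR; apply: reach_ball.
Qed.

End Away.

(** * Balls in a graph with a long shortest cycle *)

Section ForestCounts.
Variable G : sgraph.
Implicit Types (Z : {set G}) (u v w : G) (x y : nat -> G).
Hypothesis aG : acyclic G.

Lemma is_root1 v : is_root [set v].
Proof. by move=> z z' /set1P-> /set1P->; left. Qed.

Lemma is_root2 u v : sedge u v -> is_root [set u; v].
Proof.
by move=> uv z z' /set2P[]-> /set2P[]->; (try by left); right; rewrite // sedge_sym.
Qed.

Lemma card_cores_edge j u v :
  sedge u v -> #|cores G j| + #|ball setT j [set u; v]| <= #|G| + 2.
Proof.
move=> uv; have := card_away aG (is_root2 uv) (leqnn j); rewrite subnn.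
set A := [set _ in _ | _] => cA.
have : #|cores G j| <= #|A| + #|[set u; v]|.
  apply: leq_trans (leq_card_setU _ _).1; apply/subset_leq_card/subsetP => w wC.
  by rewrite in_setU inE wC /=; case: (boolP (w \in [set u; v])); rewrite ?orbT // => wN; rewrite orbF.
have : #|[set u; v]| <= 2 by rewrite cards2; case: (u != v).
by lia.
Qed.

(** With the radius one above the index, [card_away] omits only [v] and its neighbours. A core
    neighbour begins a long branch at [v], so [nbdeg] accounts for it. *)
Lemma card_cores_vertex i v :
  #|cores G i| + #|ball setT i.+1 [set v]| <= #|G| + 1 + nbdeg setT i v.
Proof.
have := card_away aG (@is_root1 v) (leqnSn i); rewrite subSnn.
set A := [set _ in _ | _] => cA.
have : #|cores G i| <= #|A| + (#|[set v]| + nbdeg setT i v).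
  apply: leq_trans (leq_trans (leq_card_setU A ([set v] :|: [set u | nbext setT i v u])).1 _); last first.
    by rewrite leq_add2l; apply: (leq_card_setU _ _).1.
  apply/subset_leq_card/subsetP => w wC; rewrite in_setU inE wC andTb.
  case: (boolP (w \in ball _ _ _)) => //=; rewrite ballS in_setU => /orP[wv|].
    by rewrite in_setU; apply/orP; left.
  rewrite inE => /andP[_ /exists_inP[_ /set1P-> vw]]; rewrite in_setU inE; apply/orP; right.
  rewrite inE.
  by apply: core_nbext_back; [move: wC; rewrite inE | rewrite sedge_sym].
by rewrite cards1; lia.
Qed.

End ForestCounts.

(** * Balls and components beside a shortest cycle *)

Section LongCycle.
Variables (G : sgraph) (p : nat) (cy : nat -> G).
Implicit Types (Z X : {set G}) (u v w : G) (x y : nat -> G).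
Hypotheses (gG : girth_gt G p.-1) (cw : cyclic_walk cy p).
Local Notation C := (cycle_set cy p).

Lemma cyclic_nbwalk s m : nbwalk (fun i => cy (s + i)) m.
Proof.
have [p2 cyE cyq] := cw; split=> i _; first by rewrite addnS.
rewrite cyq; apply/negP; rewrite -[s + i]add0n -addn2 (_ : s + (i + 2) = 2 + (s + i)); last lia.
by rewrite add0n -{1}[s + i]add0n eqn_modDr mod0n modn_small.
Qed.

Lemma walk_reach x m a b : walk x m -> a <= m -> b <= m -> x b \in reach [set x a].
Proof.
move=> xE; have from0 c : c <= m -> x c \in reach [set x 0].
  elim: c => [|c IH] cm; first by apply: (reach_ball (j := 0)); rewrite inE.
  by apply: reach_edge (IH (ltnW cm)) (xE _ _).
move=> am bm; apply: (subsetP (reach_sub _) _ (from0 b bm)).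
by rewrite sub1set reach_sym from0.
Qed.

Lemma nbwalk_reach x m a :
  nbwalk x m -> m < p -> a <= m -> m < #|reach [set x a]|.
Proof.
move=> xw mp am; have inj : injective (fun i : 'I_m.+1 => x i).
  move=> i j xij; apply/val_inj/eqP; have := ltn_ord i; have := ltn_ord j; rewrite !ltnS => jm im.
  have mp' : m <= p.-1 by lia.
  have [ij|ji|//] := ltngtP i j.
    by have := nbwalk_inj gG xw mp' (i := i) (j := j); rewrite xij eqxx; lia.
  by have := nbwalk_inj gG xw mp' (i := j) (j := i); rewrite xij eqxx; lia.
rewrite -[m.+1]card_ord -(card_codom inj); apply/subset_leq_card/subsetP => _ /codomP[i ->].
by apply: walk_reach am _; [case: xw | rewrite -ltnS].
Qed.

(** Two long branches at [u] join to a non-backtracking walk with [2i] edges, which is a path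
    because it is shorter than every cycle. *)
Lemma card_reach_core i u :
  core setT i u -> i.*2 < p -> i.*2 < #|reach [set u]|.
Proof.
case: i => [|i] uC ip.
  by apply/card_gt0P; exists u; apply: (reach_ball (j := 0)); rewrite inE.
case/card_gt1P: uC => w [w' [wu w'u ww']]; move: wu w'u; rewrite !inE => wu w'u.
have [x [xw x0 x1]] := nbext_walk wu; have [y [yw y0 y1]] := nbext_walk w'u.
have := nbwalk_cat (nbwalk_rev xw) yw; rewrite subnn x0 y0 => /(_ erefl).
rewrite subSnn x1 y1 => /(_ (fun _ _ => ww')) zw.
have := nbwalk_reach (a := i.+1) zw; rewrite /catw leqnn subnn x0 addnn.
by apply => //; lia.
Qed.

Lemma card_reach_dart i u v :
  (u, v) \in core_darts G i -> i.*2.+1 < p -> i.*2.+1 < #|reach [set u]|.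
Proof.
rewrite core_dartsE => /andP[uv vu] ip.
have [x [xw x0 x1]] := nbext_walk uv; have [y [yw y0 y1]] := nbext_walk vu.
have xw1 : nbwalk (fun a => x a.+1) i by apply: (nbwalk_shift (a := 1) xw).
have := nbwalk_cat (nbwalk_rev xw1) yw; rewrite subnn x1 y0 => /(_ erefl) H.
have {H} := H _; case: i uv vu ip xw yw xw1 => [|i] uv vu ip xw yw xw1 H.
  have := nbwalk_reach (a := 1) (H _); rewrite /catw /= y1; apply => //.
have zw : nbwalk (catw (fun a => x (i.+1 - a).+1) i.+1 y) (i.+1 + i.+2).
  apply: H => _ _; rewrite y1 -x0 (_ : (i.+1 - _).+1 = 2); last by rewrite /= subSnn.
  by rewrite eq_sym; case: xw => _; apply.
have := nbwalk_reach (a := i.+2) zw; rewrite /catw ltnn subSnn y1.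
rewrite (_ : i.+1 + i.+2 = i.+1.*2.+1); last lia.
by apply; lia.
Qed.

(** [d] is 0 when the root is a vertex and 1 when it may be an edge: the extra length that closing a
    walk through the root can cost. *)
Definition rooted (d : nat) Z : Prop :=
  {in Z &, forall z z', z = z' \/ 0 < d /\ sedge z z'} /\ #|Z| <= 2.

(** The walk closes up directly or through the edge of the root; the condition on [x m.-1] keeps
    that edge from backtracking. *)
Lemma root_closed d Z x m :
  rooted d Z -> nbwalk x m -> 0 < m -> x 0 \in Z -> x m \in Z -> x m.-1 \notin Z -> p <= m + d.
Proof.
move=> [rZ _] xw m0 x0 xm xN; have [E|[d0 e]] := rZ _ _ xm x0.
  rewrite leqNgt; apply/negP => mp.
  by have := nbwalk_closed gG xw; rewrite E eqxx; move=> /(_ _)/negP[]; lia.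
pose z b := if b is 0 then x m else x 0.
have zw : nbwalk z 1 by split=> // -[].
have cw1 : nbwalk (catw x m z) (m + 1).
  by apply: nbwalk_cat => // _ _; apply: contraNneq xN => ->.
rewrite leqNgt; apply/negP => mp.
have := nbwalk_closed gG cw1; rewrite catw_last // /catw leq0n eqxx.
by move=> /(_ _)/negP[]; lia.
Qed.

(** Going from the root to [w], over [u] to [w'] and back to the root gives a walk closed by the
    root. The geodesics must avoid [u], otherwise it could backtrack there. *)
Lemma two_parents d Z u w w' y n z n' :
  rooted d Z -> geodesic Z y n -> geodesic Z z n' -> y n = w -> z n' = w' -> w != w' ->
  sedge u w -> sedge u w' -> u \notin Z -> (forall a, a <= n -> y a != u) ->
  (forall a, a <= n' -> z a != u) -> p <= n + n' + 2 + d.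
Proof.
move=> rZ [yw y0 _ yN] [zw z0 _ zN] yn zn ww' uw uw' uZ yu zu.
pose e b := if b is 0 then w else u.
have ew : nbwalk e 1 by split=> // -[] //= _; rewrite sedge_sym.
have y1 : nbwalk (catw y n e) (n + 1).
  by apply: nbwalk_cat => // n0 _; apply: yu; lia.
pose e' b := if b is 0 then u else w'.
have e'w : nbwalk e' 1 by split=> // -[].
have z1 : nbwalk (catw e' 1 (fun i => z (n' - i))) (1 + n').
  by apply: nbwalk_cat (nbwalk_rev zw) _ _ => //; [rewrite subn0 zn | move=> _ n0; rewrite eq_sym zu //; lia].
have yz : nbwalk (catw (catw y n e) (n + 1) (catw e' 1 (fun i => z (n' - i)))) (n + 1 + (1 + n')).
  apply: nbwalk_cat => //; first by rewrite catw_last.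
  by move=> _ _; rewrite addn1 /= {1}/catw leqnn yn.
have last1 : catw e' 1 (fun i => z (n' - i)) (1 + n') = z 0.
  by rewrite catw_last ?subnn //= subn0 zn.
have join1 : catw y n e (n + 1) = catw e' 1 (fun i => z (n' - i)) 0 by rewrite catw_last.
have := root_closed rZ yz; rewrite catw_last // last1 => H.
have -> : n + n' + 2 = n + 1 + (1 + n') by lia.
apply: H => //; first by lia.
have [n0|n0] := posnP n'.
  rewrite n0 (_ : (n + 1 + (1 + 0)).-1 = n + 1); last lia.
  by rewrite {1}/catw leqnn catw_last.
have -> : catw (catw y n e) (n + 1) (catw e' 1 (fun i => z (n' - i))) (n + 1 + (1 + n')).-1 = z 1.
  rewrite (_ : _.-1 = n + 1 + n'); last lia.
  rewrite catw_last // /catw; case: ifP => [n1|n1]; last by congr z; lia.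
  by have n'1 : n' = 1 by [lia]; move: zn; rewrite n'1 => ->.
by apply: (zN 1 0).
Qed.

(** The only neighbour of [u] in the ball is its predecessor on a geodesic: any other would close a
    walk with at most [2r + 1 + d] edges, fewer than [p]. *)
Lemma unique_parent d j Z r u :
  rooted d Z -> j.*2 + d + 2 <= p -> 0 < r <= j -> u \in ball setT r Z -> u \notin ball setT r.-1 Z ->
  {in ball setT r Z &, forall w w', sedge u w -> sedge u w' -> w = w'}.
Proof.
move=> rZ jp /andP[r0 rj] ur uNr.
have [g [m [gg mr gm]]] := geodesic_ex ur.
have [_ _ gB gN] := gg.
have mE : m = r.
  apply/eqP; rewrite eqn_leq mr /= leqNgt; apply: contra uNr => mr'.
  by rewrite -gm; apply: (subsetP (ball_le setT Z _)) (gB m (leqnn m)); lia.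
have uZ : u \notin Z by apply: contra uNr; apply/subsetP/(ball_le setT Z (leq0n _)).
suff par w : w \in ball setT r Z -> sedge u w -> w = g r.-1.
  by move=> w w' wr w'r uw uw'; rewrite (par w) // (par w').
move=> wr uw; apply/eqP; apply: contraT => wg.
have [y [n [yg nr yn]]] := geodesic_ex wr; have [_ _ yB _] := yg.
have gg' : geodesic Z g r.-1.
  case: gg => gw g0 _ _; split=> // [|a am|a b /andP[ba am]].
  - by apply: nbwalk_take gw _; lia.
  - by apply: gB; lia.
  by apply: gN; lia.
have ug : sedge u (g r.-1).
  have [[gE _] _ _ _] := gg; rewrite sedge_sym -gm mE -{2}(prednK r0); apply: gE; lia.
suff : p <= n + r.-1 + 2 + d by lia.
apply: (two_parents rZ yg gg' yn erefl wg uw ug uZ) => a am.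
  have [->|an] := eqVneq a n; first by rewrite yn; apply: contraTneq uw => ->; rewrite sedge_irr.
  apply: contraNneq uNr => <-; apply: (subsetP (ball_le setT Z _)) (yB a am); lia.
by apply: contraNneq uNr => <-; apply: (subsetP (ball_le setT Z am)); apply: gB; lia.
Qed.

(** Otherwise a cycle vertex farthest from the root would have both its cycle neighbours in the ball
    of its own radius, against [unique_parent]. *)
Lemma cycle_not_in_ball d j Z :
  rooted d Z -> j.*2 + d + 2 <= p -> exists s, cy s \notin ball setT j Z.
Proof.
move=> rZ jp; have [p2 cyE cyq] := cw.
have cy_mod s : cy s = cy (s %% p) by apply/eqP; rewrite cyq modn_mod.
pose all_in r := [forall a : 'I_p, cy a \in ball setT r Z].
have [allj|] := boolP (all_in j); last by move/forallPn => [a aN]; exists a.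
have ex : exists r, all_in r by exists j.
case: (ex_minnP ex) => r allr rmin {ex}.
have allP s : cy s \in ball setT r Z.
  have sp : s %% p < p by rewrite ltn_mod; lia.
  by rewrite cy_mod; apply: (forallP allr (Ordinal sp)).
have r0 : 0 < r.
  rewrite lt0n; apply/eqP => r0; have [_] := rZ; rewrite leqNgt => /negP[].
  apply: leq_trans p2 _; rewrite -(card_cycle_set cw).
  apply/subset_leq_card/subsetP => _ /(cycle_setP _ cw)[s ->].
  by have := allP s; rewrite r0.
have : ~~ all_in r.-1 by apply/negP => /rmin; lia.
(* [a + p.-1] plays the part of [a - 1], so that [cy s] and [cy s.+2] are the two cycle neighbours
   of [cy a]. *)
case/forallPn => a aN; pose s := a + p.-1.
have s1E : cy s.+1 = cy a.
  by apply/eqP; rewrite cyq (_ : s.+1 = a + p) ?modnDr // /s; lia.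
have up := @unique_parent d j Z r (cy s.+1) rZ jp _ (allP _) _.
have : cy s = cy s.+2.
  apply: up; rewrite ?allP ?s1E //.
  - by rewrite r0 /=; apply: rmin.
  - by rewrite -s1E sedge_sym.
  - by rewrite -s1E.
by move=> /eqP; rewrite (negbTE ((cyclic_nbwalk 0 s.+2).2 s (ltnSn _))).
Qed.

Lemma ball_walk d j Z a b :
  rooted d Z -> a \in ball setT j Z -> b \in ball setT j Z ->
  exists x m, [/\ nbwalk x m, m <= j.*2 + d, x 0 = a, x m = b &
                 forall i, i <= m -> x i \in ball setT j Z].
Proof.
move=> [rZ _] aj bj; have [x [m [[[xE _] x0 xB _] mj xm]]] := geodesic_ex aj.
have [y [n [[[yE _] y0 yB _] nj yn]]] := geodesic_ex bj.
have xj i : i <= m -> x i \in ball setT j Z.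
  by move=> im; apply: (subsetP (ball_le setT Z (leq_trans im mj))); apply: xB.
have yj i : i <= n -> y i \in ball setT j Z.
  by move=> im; apply: (subsetP (ball_le setT Z (leq_trans im nj))); apply: yB.
suff [w [l [wE ld w0 wl wj]]] : exists (w : nat -> G) l, [/\ walk w l, l <= j.*2 + d, w 0 = a, w l = b &
    forall i, i <= l -> w i \in ball setT j Z].
  have [w' [l' [w'n l'l w'0 w'l w'j]]] := nbwalk_reduce wE wj.
  by exists w', l'; rewrite w'0 w'l; split=> //; apply: leq_trans ld.
have [E|[d0 e]] := rZ _ _ x0 y0.
  exists (catw (fun i => x (m - i)) m y), (m + n); split.
  - move=> i im; rewrite /catw; have [im'|im'] := ltnP i m.
      rewrite ltnW // sedge_sym (_ : m - i = (m - i.+1).+1); [by apply: xE; lia | lia].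
    have [->|iNm] := eqVneq i m; first by rewrite leqnn subnn E subSnn yE //; lia.
    have -> : (i <= m) = false by lia.
    by have -> : i.+1 - m = (i - m).+1 by [lia]; apply: yE; lia.
  - by lia.
  - by rewrite /catw leq0n subn0 xm.
  - by rewrite catw_last ?yn // subnn.
  by move=> i im; rewrite /catw; case: ifP => im'; [apply: xj | apply: yj]; lia.
exists (catw (fun i => x (m - i)) m (fun i => if i is i'.+1 then y i' else x 0)), (m + n.+1); split.
- move=> i im; rewrite /catw; have [im'|im'] := ltnP i m.
    rewrite ltnW // sedge_sym (_ : m - i = (m - i.+1).+1); [by apply: xE; lia | lia].
  have [->|iNm] := eqVneq i m; first by rewrite leqnn subnn subSnn.
  have -> : (i <= m) = false by lia.
  have -> : i.+1 - m = (i - m).+1 by lia.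
  by case E : (i - m) => [|c]; [lia | apply: yE; lia].
- by lia.
- by rewrite /catw leq0n subn0 xm.
- by rewrite catw_last ?yn // subnn.
move=> i im; rewrite /catw; case: ifP => im'; first by apply: xj; lia.
have : i - m <= n.+1 by lia.
by case: (i - m) => [|c] cn; [apply: xj | apply: yj].
Qed.

(* A stretch of the cycle outside the ball closes up through the ball to a cycle of length >= p. *)
Lemma card_ball_cycle d j Z :
  rooted d Z -> j.*2 + d + 2 <= p -> #|C :&: ball setT j Z| <= j.*2 + d + 1.
Proof.
move=> rZ jp; have [p2 cyE cyq] := cw; set X := ball setT j Z.
have [->|] := eqVneq (C :&: X) set0; first by rewrite cards0.
case/set0Pn => _ /setIP[/(cycle_setP _ cw)[a ->] aX].
have [b bX] := cycle_not_in_ball rZ jp.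
have shift s t : cy (s + t * p) = cy s by apply/eqP; rewrite cyq addnC modnMDl.
have ex1 : exists e, cy (a + e) \notin X.
  by exists (b + a * p - a); rewrite subnKC ?shift //; nia.
case: (ex_minnP ex1) => e eN emin {ex1 b bX}.
have e0 : 0 < e by rewrite lt0n; apply: contraNneq eN => ->; rewrite addn0.
(* [cy s] is the last vertex before the cycle leaves the ball, [cy (s.+1 + g)] the first one back
   inside; the [g] vertices between them lie outside. *)
pose s := a + e.-1.
have sX : cy s \in X by apply: contraT => /emin; lia.
have ex2 : exists g, cy (s.+1 + g) \in X.
  by exists p.-1; rewrite (_ : s.+1 + p.-1 = s + 1 * p) ?shift //; lia.
case: (ex_minnP ex2) => g gX gmin {ex2}.
have s1 : cy s.+1 \notin X by rewrite /s (_ : (a + e.-1).+1 = a + e) //; lia.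
have g0 : 0 < g by rewrite lt0n; apply: contraNneq s1 => g0; move: gX; rewrite g0 addn0.
have gp : g <= p.-1 by apply: gmin; rewrite (_ : s.+1 + p.-1 = s + 1 * p) ?shift //; lia.
have gN c : c < g -> cy (s.+1 + c) \notin X by move=> cg; apply/negP => /gmin; lia.
have [x [m [xw md x0 xm xX]]] := ball_walk rZ gX sX.
have zw := cyclic_nbwalk s g.+1.
have zx : nbwalk (catw (fun i => cy (s + i)) g.+1 x) (g.+1 + m).
  apply: nbwalk_cat => // [|_ m0]; first by rewrite x0 addSnnS.
  apply: contraNneq (gN g.-1 _) => [E|]; last by lia.
  by rewrite (_ : s.+1 + g.-1 = s + g.+1.-1) ?E ?xX //; lia.
have pg : p <= g.+1 + m.
  rewrite leqNgt; apply/negP => H; have := nbwalk_closed gG zx.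
  rewrite catw_last ?x0 ?addSnnS // /catw leq0n addn0 xm eqxx.
  by move=> /(_ _)/negP[]; lia.
pose N := [set cy (s.+1 + c) | c : 'I_g].
have cN : #|N| = g.
  rewrite card_imset ?card_ord // => c c' /eqP; have := ltn_ord c; have := ltn_ord c' => c'g cg.
  by rewrite cyq eqn_modDl modn_small 1?modn_small; [move=> /eqP/val_inj | lia | lia].
have : #|(C :&: X) :|: N| <= p.
  rewrite -[X in _ <= X](card_cycle_set cw); apply/subset_leq_card; rewrite subUset subsetIl.
  by apply/subsetP => _ /imsetP[c _ ->]; apply/(cycle_setP _ cw); exists (s.+1 + c).
rewrite cardsU (_ : _ :&: N = set0) ?cards0; first by lia.
apply/setP => y; rewrite [RHS]inE; apply/negP => /setIP[/setIP[_ yX] /imsetP[c _ yE]].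
by have := gN c (ltn_ord c); rewrite -yE yX.
Qed.

(** A ball that misses the cycle leaves room for its [p] vertices. A ball that meets it lies in the
    component of the cycle, so the component of [u] avoids both, and their overlap is bounded by
    [card_ball_cycle]. *)
Lemma card_ball_bound d j Z u :
  rooted d Z -> j.*2 + d + 2 <= p -> u \notin reach C ->
  #|ball setT j Z| + p <= #|G| \/
  #|ball setT j Z| + p + #|reach [set u]| <= #|G| + j.*2 + d + 1.
Proof.
move=> rZ jp uC; have := card_ball_cycle rZ jp; set X := ball setT j Z => CX.
have [CX0|] := eqVneq (C :&: X) set0.
  left; rewrite -[X in _ + X](card_cycle_set cw) addnC; have := cardsUI C X; rewrite CX0 cards0 addn0 => <-.
  exact: max_card.
case/set0Pn => c /setIP[cC cX]; right.
have XR : X \subset reach C.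
  apply/subsetP => y yX; have [x [m [[xE _] _ x0 xm _]]] := ball_walk rZ cX yX.
  have := walk_reach xE (leq0n m) (leqnn m); rewrite x0 xm; apply: subsetP.
  by apply: reach_sub; rewrite sub1set; apply: (reach_ball (j := 0)).
have CR : C \subset reach C by apply/subsetP => y yC; apply: (reach_ball (j := 0)).
have dis : [disjoint C :|: X & reach [set u]].
  rewrite disjoint_subset; apply/subsetP => y yCX; rewrite inE; apply: contra uC.
  rewrite reach_sym => uy; apply: (subsetP (reach_sub _) _ uy).
  by rewrite sub1set; move: y yCX {uy}; apply/subsetP; rewrite subUset CR.
have := cardsUI C X; have : #|(C :|: X) :|: reach [set u]| <= #|G| by apply: max_card.
have /eqP-> : #|(C :|: X) :|: reach [set u]| == #|C :|: X| + #|reach [set u]|.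
  by rewrite (leq_card_setU (C :|: X) (reach [set u])).
by rewrite (card_cycle_set cw); move: CX; lia.
Qed.

End LongCycle.

(** * The surroundings of a shortest cycle *)

Section ShortestCycle.
Variables (G : sgraph) (p : nat) (cy : nat -> G).
Implicit Types (Z X : {set G}) (u v w : G) (x y : nat -> G).
Hypotheses (gG : girth_gt G p.-1) (cw : cyclic_walk cy p).
Local Notation C := (cycle_set cy p).

Lemma cy_shift s t : cy (s + t * p) = cy s.
Proof. by have [_ _ cyE] := cw; apply/eqP; rewrite cyE addnC modnMDl. Qed.

Lemma cy_in s : cy s \in C.
Proof. by apply/(cycle_setP _ cw); exists s. Qed.

Lemma cy_nbext i s : nbext setT i (cy s) (cy s.+1).
Proof.
have := @walk_nbext _ setT i _ (cyclic_nbwalk cw s i.+1).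
by rewrite addn0 addn1; apply.
Qed.

Lemma cy_nbext_back i s : nbext setT i (cy s.+1) (cy s).
Proof.
(* The walk starts [i] places before [s] and is read backwards; the added [i * p] keeps its index
   natural. *)
have [p2 _ _] := cw; set s' := s + i * p - i.
have := @walk_nbext _ setT i _ (nbwalk_rev (cyclic_nbwalk cw s' i.+1)).
rewrite (_ : s' + (i.+1 - 0) = s.+1 + i * p); last by rewrite /s'; nia.
rewrite (_ : s' + (i.+1 - 1) = s + i * p); last by rewrite /s'; nia.
by rewrite !cy_shift; apply.
Qed.

Lemma cycle_sub_cores i : C \subset cores G i.
Proof.
apply/subsetP => _ /(cycle_setP _ cw)[s ->]; rewrite inE.
by apply: (@core_darts_core _ _ _ (cy s.+1)); rewrite core_dartsE cy_nbext cy_nbext_back.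
Qed.

Definition cycle_darts : {set G * G} :=
  [set (cy a, cy a.+1) | a : 'I_p] :|: [set (cy a.+1, cy a) | a : 'I_p].

Lemma cycle_dartsP u v :
  reflect (exists a, (u, v) = (cy a, cy a.+1) \/ (u, v) = (cy a.+1, cy a)) ((u, v) \in cycle_darts).
Proof.
have [p2 _ cyE] := cw; apply: (iffP setUP) => [[]/imsetP[a _ ->]|[a H]]; [by exists a; left | by exists a; right|].
have ap : a %% p < p by rewrite ltn_mod; lia.
have aE : cy (a %% p) = cy a by apply/eqP; rewrite cyE modn_mod.
have aE1 : cy (a %% p).+1 = cy a.+1 by apply/eqP; rewrite cyE -addn1 modnDml addn1.
by case: H => ->; [left | right]; apply/imsetP; exists (Ordinal ap); rewrite //= aE aE1.
Qed.

Lemma cycle_darts_sub i : cycle_darts \subset core_darts G i.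
Proof.
by apply/subsetP => -[u v] /cycle_dartsP[a [] [-> ->]]; rewrite core_dartsE cy_nbext cy_nbext_back.
Qed.

Lemma card_cycle_darts : #|cycle_darts| = 2 * p.
Proof.
have [p2 _ cyE] := cw.
have inj : injective (fun a : 'I_p => cy a).
  by move=> a b /eqP; rewrite cyE !modn_small // => /eqP/val_inj.
rewrite /cycle_darts cardsU !card_imset; [|by move=> a b [_ /inj]|by move=> a b [/inj]].
rewrite !card_ord (_ : _ :&: _ = set0) ?cards0; first by lia.
apply/setP => x; rewrite inE in_set0; apply/negP => /andP[/imsetP[a _ ->] /imsetP[b _ [/eqP h1 /eqP h2]]].
move: h1 h2; rewrite !cyE => /eqP h1 /eqP h2.
have h3 : (a.+1 + 1) %% p = (b + 1) %% p by rewrite -modnDml h2 modnDml.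
have : 2 + a == 0 + a %[mod p].
  by rewrite (_ : 2 + a = a.+1 + 1) ?h3 ?addn1 -?h1 //; lia.
by rewrite eqn_modDr mod0n modn_small.
Qed.

Lemma cycle_darts_sym u v : ((u, v) \in cycle_darts) = ((v, u) \in cycle_darts).
Proof.
by apply/cycle_dartsP/cycle_dartsP => -[a [] [-> ->]]; exists a; [right | left | right | left].
Qed.

Lemma cycle_neighbours u :
  #|[set w | (u, w) \in cycle_darts]| <= 2 * (u \in C).
Proof.
have [p2 _ cyE] := cw.
case: (boolP (u \in C)) => [/(cycle_setP _ cw)[s ->]|uC]; last first.
  rewrite leqn0 cards_eq0; apply/eqP/setP => w; rewrite inE in_set0; apply/negP.
  by move=> /cycle_dartsP[a [] [uE _]]; rewrite uE cy_in in uC.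
apply: leq_trans (_ : #|[set cy s.+1; cy (s + p.-1)]| <= _); last by rewrite cards2; case: (_ != _).
apply/subset_leq_card/subsetP => w; rewrite inE => /cycle_dartsP[a [] [/eqP sa ->]].
  apply/set2P; left; apply/eqP; rewrite cyE -[a.+1]addn1 -[s.+1]addn1.
  by rewrite -modnDml -[in X in _ == X]modnDml; move: sa; rewrite cyE => /eqP->.
apply/set2P; right; apply/eqP; rewrite cyE; move: sa; rewrite cyE => /eqP sa.
rewrite -modnDml sa modnDml (_ : a.+1 + p.-1 = a + p) ?modnDr //; lia.
Qed.

Lemma cy_offset s t : cy s != cy t -> exists2 e, 0 < e < p & cy t = cy (s + e).
Proof.
have [p2 _ cyE] := cw => st; exists ((t + p.-1 * s) %% p); last first.
  apply/eqP; rewrite cyE modnDmr (_ : s + (t + p.-1 * s) = s * p + t) ?modnMDl //; nia.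
rewrite ltn_mod lt0n (_ : 0 < p) ?andbT; last by lia.
apply: contraNneq st => e0; rewrite cyE.
have -> : s %% p = (s + (t + p.-1 * s)) %% p by rewrite -modnDmr e0 addn0.
by rewrite (_ : s + (t + p.-1 * s) = s * p + t) ?modnMDl //; nia.
Qed.

(** A chord together with one of the two arcs between its ends would be a shorter cycle. *)
Lemma no_chord u v : u \in C -> v \in C -> sedge u v -> (u, v) \in cycle_darts.
Proof.
have [p2 _ cyE] := cw => /(cycle_setP _ cw)[s ->] /(cycle_setP _ cw)[t ->] st.
have neq : cy s != cy t by apply: contraTneq st => ->; rewrite sedge_irr.
have [e /andP[e0 ep] tE] := cy_offset neq; apply/cycle_dartsP.
have [e1|e1] := eqVneq e.+1 p.
  exists (s + e); right; rewrite tE; congr (_, _).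
  by rewrite -addnS e1 -[p in s + p]mul1n cy_shift.
pose z b := if b is 0 then cy s else cy t.
have zw : nbwalk z 1 by split=> // -[].
have zc : nbwalk (catw z 1 (fun a => cy (s + e + a))) (1 + (p - e)).
  apply: nbwalk_cat => //; [exact: (cyclic_nbwalk cw (s + e)) | by rewrite addn0 |move=> _ _ /=].
  by rewrite cyE -{1}[s]addn0 -addnA eqn_modDl mod0n modn_small; lia.
exists s; left; congr (_, _); suff -> : cy t = cy (s + 1) by rewrite addn1.
rewrite tE; congr (cy (s + _)); apply/eqP; rewrite eqn_leq e0 andbT leqNgt; apply/negP => e2.
have := nbwalk_closed gG zc; rewrite catw_last ?addn0 // (_ : s + e + (p - e) = s + 1 * p); last lia.
by rewrite cy_shift /catw /= eqxx => /(_ _)/negP[]; lia.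
Qed.

(** The ear closes up with either arc, of length [e] or [p - e]. Neither closed walk is shorter than
    [p], so [m] is at least [p - e] and at least [e]. *)
Lemma ear_bound x m :
  nbwalk x m -> 1 < m -> x 0 \in C -> x m \in C -> x 0 != x m ->
  (forall a, 0 < a < m -> x a \notin C) -> p <= 2 * m.
Proof.
move=> xw m1 /(cycle_setP _ cw)[s x0] /(cycle_setP _ cw)[t xm]; rewrite x0 xm => st xN.
have [e /andP[e0 ep] tE] := cy_offset st.
have lastN : x m.-1 \notin C by apply: xN; lia.
have w1 : nbwalk (catw x m (fun a => cy (s + e + a))) (m + (p - e)).
  apply: nbwalk_cat => //; [exact: (cyclic_nbwalk cw (s + e)) | by rewrite addn0 xm | move=> _ _].
  by apply: contraNneq lastN => ->; apply: cy_in.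
have w2 : nbwalk (catw x m (fun a => cy (s + (e - a)))) (m + e).
  apply: nbwalk_cat => //; [exact: (nbwalk_rev (cyclic_nbwalk cw s e)) | by rewrite subn0 xm | move=> _ _].
  by apply: contraNneq lastN => ->; apply: cy_in.
have : p <= m + (p - e).
  rewrite leqNgt; apply/negP => H; have := nbwalk_closed gG w1.
  rewrite catw_last ?addn0 ?xm // (_ : s + e + (p - e) = s + 1 * p); last lia.
  by rewrite cy_shift /catw /= x0 eqxx => /(_ _)/negP[]; lia.
have : p <= m + e; last by lia.
rewrite leqNgt; apply/negP => H; have := nbwalk_closed gG w2.
rewrite catw_last ?subn0 ?xm // subnn addn0.
by rewrite /catw /= x0 eqxx => /(_ _)/negP[]; lia.
Qed.

Definition off_cycle (i : nat) u : {set G} := [set w | nbext setT i u w & (u, w) \notin cycle_darts].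

Definition off_darts (i : nat) u : {set G * G} :=
  [set (u, w) | w in off_cycle i u] :|: [set (w, u) | w in off_cycle i u].

Lemma nbdeg_off_cycle i u : nbdeg setT i u <= 2 * (u \in C) + #|off_cycle i u|.
Proof.
apply: leq_trans (_ : #|[set w | (u, w) \in cycle_darts] :|: off_cycle i u| <= _).
  apply/subset_leq_card/subsetP => w; rewrite inE => uw.
  by rewrite in_setU [X in X || _]inE [X in _ || X]inE uw /= orbN.
by apply: leq_trans (leq_card_setU _ _).1 _; rewrite leq_add2r cycle_neighbours.
Qed.

Lemma card_off_darts i u : #|off_darts i u| = 2 * #|off_cycle i u|.
Proof.
rewrite cardsU !card_imset; [|by move=> a b []|by move=> a b []].
rewrite (_ : _ :&: _ = set0) ?cards0; first by lia.
apply/setP => x; rewrite inE in_set0; apply/negP => /andP[/imsetP[a aU ->] /imsetP[b _ [_ E]]].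
by move: aU; rewrite inE E => /andP[/nbext_mem[_ _]]; rewrite sedge_irr.
Qed.

Lemma off_darts_sub i u :
  core setT i.+1 u -> off_darts i u \subset core_darts G i :\: cycle_darts.
Proof.
move=> uC; rewrite subUset; apply/andP; split; apply/subsetP => x /imsetP[w].
  by rewrite inE => /andP[uw wN] ->; rewrite in_setD wN core_core_darts.
by rewrite inE => /andP[uw wN] ->; rewrite in_setD cycle_darts_sym wN core_darts_sym core_core_darts.
Qed.

Lemma card_off_cycle i u :
  core setT i.+1 u -> 2 * #|off_cycle i u| <= #|core_darts G i| - 2 * p.
Proof.
move=> uC; rewrite -card_off_darts -card_cycle_darts -(setIidPr (cycle_darts_sub i)) -cardsD.
by apply/subset_leq_card/off_darts_sub.
Qed.

End ShortestCycle.

(** * Spiders in forests *)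

Lemma walk_ball (G : sgraph) (S Z : {set G}) (x : nat -> G) m a :
  walk x m -> (forall b, b <= m -> x b \in S) -> x 0 \in Z -> a <= m -> x a \in ball S a Z.
Proof.
move=> xE xS x0; elim: a => [|a IH] am //.
by apply: ball_step (IH (ltnW am)) (xS _ am) (xE _ am).
Qed.

Section Spiders.
Variables (F : sgraph) (i : nat) (v : F) (L : F -> nat -> F).
Implicit Types (U : {set F}) (t w : F).
Hypothesis aF : acyclic F.
Hypothesis legs : forall w, nbext setT i v w -> [/\ nbwalk (L w) i.+1, L w 0 = v & L w 1 = w].

Lemma leg_inj w w' a b :
  nbext setT i v w -> nbext setT i v w' -> 0 < a <= i.+1 -> 0 < b <= i.+1 ->
  L w a = L w' b -> w = w' /\ a = b.
Proof.
move=> /legs[xw x0 x1] /legs[yw y0 y1] /andP[a0 ai] /andP[b0 bi] E.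
have [|ab xy] := nbwalk_unique (acyclic_girth (a + b) aF) (nbwalk_take xw ai) (nbwalk_take yw bi) (leqnn _) _ E.
  by rewrite x0 y0.
by split; rewrite // -x1 -y1; apply: xy.
Qed.

Lemma leg_root w a : nbext setT i v w -> 0 < a <= i.+1 -> L w a != v.
Proof.
move=> /legs[xw x0 _] /andP[a0 ai].
have := nbwalk_closed (acyclic_girth a aF) (nbwalk_take xw ai).
by rewrite x0 eq_sym; apply; rewrite a0 leqnn.
Qed.

(* The tip of the leg through [t] is cut; all legs are complete when [t] is not in [U]. *)
Definition spider U t : {set F} :=
  v |: [set L y.1 (y.2 : 'I_i.+1).+1 | y in setX U [set: 'I_i.+1] :\ (t, ord_max)].

Lemma spider_root U t : v \in spider U t.
Proof. exact: setU11. Qed.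

Variables (U : {set F}) (t : F).
Hypothesis UD : forall w, w \in U -> nbext setT i v w.

Lemma spider_leg w a : w \in U -> a <= i -> ~~ ((w == t) && (a == i)) -> L w a.+1 \in spider U t.
Proof.
move=> wU ai wa; rewrite in_setU; apply/orP; right; apply/imsetP.
exists (w, inord a); last by rewrite /= inordK.
rewrite !inE wU !andbT xpair_eqE; apply: contra wa => /andP[-> /eqP/(congr1 val)/=].
by rewrite inordK // => ->; rewrite eqxx.
Qed.

Lemma spider_tip : t \in U -> L t i.+1 \notin spider U t.
Proof.
move=> tU; rewrite in_setU1 negb_or leg_root ?UD ?leqnn //=.
apply/imsetP => -[[w a]] /=; rewrite !inE /= => /andP[waN /andP[wU _]] E.
have ai : 0 < a.+1 <= i.+1 by rewrite ltn_ord.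
have [tw ia] := leg_inj (UD tU) (UD wU) (introT andP (conj (ltn0Sn i) (leqnn _))) ai E.
case/negP: waN; rewrite xpair_eqE tw eqxx /=; apply/eqP/val_inj => /=.
by case: ia.
Qed.

Lemma card_spider : #|spider U t| + (t \in U) = 1 + #|U| * i.+1.
Proof.
rewrite cardsU1 card_in_imset; last first.
  move=> [w a] [w' b]; rewrite !inE /= => /and3P[_ wU _] /and3P[_ w'U _] E.
  have ai : 0 < a.+1 <= i.+1 by rewrite ltn_ord.
  have bi : 0 < b.+1 <= i.+1 by rewrite ltn_ord.
  by have [-> [/val_inj->]] := leg_inj (UD wU) (UD w'U) ai bi E.
have -> : v \notin [set L y.1 (y.2 : 'I_i.+1).+1 | y in setX U [set: 'I_i.+1] :\ (t, ord_max)].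
  apply/imsetP => -[[w a]] /=; rewrite !inE /= => /and3P[_ wU _] E.
  by have := @leg_root w a.+1 (UD wU); rewrite -E eqxx ltn_ord => /(_ isT).
have := cardsD1 (t, ord_max) (setX U [set: 'I_i.+1]); rewrite cardsX cardsT card_ord => ->.
by rewrite !inE andbT /= -addnA [#|_| + _]addnC.
Qed.

Lemma spider_legP w a :
  w \in U -> a <= i.+1 -> ~~ ((w == t) && (a == i.+1)) -> L w a \in spider U t.
Proof.
case: a => [|a] wU ai wa; last exact: spider_leg.
by have [_ -> _] := legs (UD wU); rewrite setU11.
Qed.

Lemma spider_sub_ball : spider U t \subset ball (spider U t) i.+1 [set v].
Proof.
apply/subsetP => u; rewrite {1}/spider in_setU1 => /orP[/eqP->|].
  by apply: (subsetP (ball_le _ _ (leq0n _))); rewrite inE.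
case/imsetP => -[w a] /setD1P[waN /setXP[wU _]] ->.
have [[xE _] x0 _] := legs (UD wU).
apply: (subsetP (ball_le (spider U t) [set v] (ltn_ord a))) => /=.
apply: (@walk_ball _ _ _ (L w) a.+1) => //; last by rewrite x0 inE.
  by move=> b ba; apply: xE; have := ltn_ord a; lia.
move=> b ba; apply: spider_legP => //; first by have := ltn_ord a; lia.
apply: contra waN => /andP[/eqP-> /eqP bi]; rewrite xpair_eqE eqxx /=.
by apply/eqP/val_inj => /=; have := ltn_ord a; lia.
Qed.

Lemma spider_nbdeg : #|U :\ t| <= nbdeg (spider U t) i v.
Proof.
apply/subset_leq_card/subsetP => w; rewrite !inE => /andP[wt wU].
have [xw x0 x1] := legs (UD wU); rewrite -x0 -{2}x1; apply: walk_nbext => // a ai.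
by apply: spider_legP; rewrite // (negbTE wt).
Qed.

(** The leg with the cut tip still has [i] edges, so one step below full length all legs count. *)
Lemma spider_nbdeg_pred : 0 < i -> #|U| <= nbdeg (spider U t) i.-1 v.
Proof.
move=> i0; apply/subset_leq_card/subsetP => w wU; rewrite inE.
have [xw x0 x1] := legs (UD wU); rewrite -x0 -{2}x1; apply: walk_nbext => [|a ai].
  by apply: nbwalk_take xw _; lia.
by apply: spider_legP => //; [lia | rewrite negb_and; apply/orP; right; lia].
Qed.

Lemma spider_good : 1 < #|U :\ t| -> good (spider U t) i.+1.*2 (v, v).
Proof.
move=> U1; rewrite /good /central /blob odd_double doubleK /= setUid spider_sub_ball andbT eqxx /=.
exact: leq_trans spider_nbdeg.
Qed.

End Spiders.

Lemma legs_exist (F : sgraph) i (v : F) : exists L : F -> nat -> F,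
  forall w, nbext setT i v w -> [/\ nbwalk (L w) i.+1, L w 0 = v & L w 1 = w].
Proof.
apply: (@fin_all_exists F (fun _ => nat -> F)
  (fun w x => nbext setT i v w -> [/\ nbwalk x i.+1, x 0 = v & x 1 = w])) => w.
have [/nbext_walk[x xP]|_] := boolP (nbext setT i v w); first by exists x.
by exists (fun=> v).
Qed.

(** * Comparing a forest with a graph containing a cycle *)

Lemma subset_of_card (T : finType) (A : {set T}) m :
  m <= #|A| -> exists2 B : {set T}, B \subset A & #|B| = m.
Proof.
move=> mA; exists [set x in take m (enum A)].
  by apply/subsetP => x; rewrite inE => /mem_take; rewrite mem_enum.
rewrite cardsE; have /card_uniqP-> : uniq (take m (enum A)) by rewrite take_uniq ?enum_uniq.
by rewrite size_takel // -cardE.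
Qed.

Section Comparison.
Variables (k p : nat) (F G : sgraph) (cy : nat -> G).
Hypotheses (aF : acyclic F) (nFG : #|F| = #|G|) (kn : k <= #|F|) (nk : #|F| < 2 * k).
Hypotheses (k1 : 1 < k) (FG : same_deck k F G).
Hypotheses (gG : girth_gt G p.-1) (cw : cyclic_walk cy p) (kp : k < p).
Local Notation C := (cycle_set cy p).

Lemma card_core_darts_eq i :
  fits i.*2.+1 k F -> fits i.*2.+1 k G -> #|core_darts F i| = #|core_darts G i|.
Proof. exact: card_central_eq. Qed.

Lemma card_cores_eq i : fits i.*2 k F -> fits i.*2 k G -> #|cores F i| = #|cores G i|.
Proof. exact: card_core_eq. Qed.

Lemma cores_large i : p <= #|cores G i|.
Proof. by rewrite -(card_cycle_set cw); apply/subset_leq_card/cycle_sub_cores. Qed.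

Lemma unreached (i : nat) (W : {set G}) :
  W \subset cores G i -> #|core_darts G i| < 2 * #|W| -> exists2 u, u \in W & u \notin reach C.
Proof.
move=> WC dW; apply/exists_inP; apply: contraT; rewrite negb_exists_in => /forall_inP WR.
suff : 2 * #|W| <= #|core_darts G i| by rewrite leqNgt dW.
apply: leq_trans (cycle_core_darts i cw); rewrite leq_mul2l /=.
by apply/subset_leq_card/subsetP => u uW; rewrite in_set (subsetP WC) //; exact: negbNE (WR u uW).
Qed.

(** The vertices compared with central edges are, for even [E], the cores of level [E - 2], and for
    odd [E] the ends of the edges of level [E - 2], whose number [card_core_darts] extracts from the
    deck. Such a vertex lies on a path with at least [E - 1] vertices. *)
Lemma far_component E :
  1 < E <= k -> (forall D, D < E -> fits D k F /\ fits D k G) ->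
  exists2 u, u \notin reach C & E.-1 <= #|reach [set u]|.
Proof.
move=> /andP[E1 Ek] fit; pose i := E.-2./2.
have [dF dG] : fits i.*2.+1 k F /\ fits i.*2.+1 k G.
  by apply: fit; rewrite /i; have := odd_double_half E.-2; lia.
have dE := card_core_darts_eq dF dG.
have [oE|eE] := boolP (odd E.-2).
  have EE : E = i.+1.*2.+1 by rewrite /i; have := odd_double_half E.-2; rewrite oE; lia.
  have [cF cG] : fits i.+1.*2 k F /\ fits i.+1.*2 k G by apply: fit; lia.
  have cE := card_cores_eq cF cG; have sE := sum_nbdeg_eq nFG kn FG cF cG.
  have endsE : #|dart_ends F i| = #|dart_ends G i|.
    by have := card_core_darts F i; have := card_core_darts G i; move: dE cE sE; lia.
  have ends0 : dart_ends F i != set0.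
    rewrite -card_gt0 endsE card_gt0; apply/set0Pn; exists (cy 0); rewrite inE.
    apply/existsP; exists (cy 1); apply: (subsetP (cycle_darts_sub cw i)).
    by apply/(cycle_dartsP cw); exists 0; left.
  have := core_darts_forest aF ends0 _; rewrite endsE => /(_ i) H.
  have [||u uW uC] := @unreached i (dart_ends G i).
  - by apply/subsetP => u; rewrite inE => /existsP[v uv]; rewrite inE (core_darts_core uv).
  - rewrite -dE; suff : #|core_darts F i| + 2 <= 2 * #|dart_ends G i| by lia.
    by apply: H => u v uv; rewrite inE; apply/existsP; exists v.
  exists u => //; move: uW; rewrite inE => /existsP[v uv].
  by have := card_reach_dart gG uv; lia.
have EE : E = i.*2.+2 by rewrite /i; have := odd_double_half E.-2; rewrite (negbTE eE); lia.
have [cF cG] : fits i.*2 k F /\ fits i.*2 k G by apply: fit; lia.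
have cE := card_cores_eq cF cG.
have cores0 : cores F i != set0 by rewrite -card_gt0 cE; have := cores_large i; lia.
have := core_darts_forest aF cores0 _; rewrite cE => /(_ i) H.
have [|u uW uC] := unreached (subxx (cores G i)).
  rewrite -dE; suff : #|core_darts F i| + 2 <= 2 * #|cores G i| by lia.
  by apply: H => u v uv; rewrite inE (core_darts_core uv).
exists u => //; move: uW; rewrite inE => uW.
by have := card_reach_core gG uW; lia.
Qed.

Lemma central_rooted (H : sgraph) D (x : H * H) :
  central setT D x -> rooted (odd D) [set x.1; x.2].
Proof.
rewrite /central; case: ifP => _ /andP[]; last first.
  move=> /eqP <- _; rewrite setUid; split; last by rewrite cards1.
  by move=> z z' /set1P-> /set1P->; left.
move=> /nbext_mem[_ _ e] _; split; last by rewrite cards2; case: (_ != _).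
by move=> z z' /set2P[]-> /set2P[]->; (try by left); right; rewrite // sedge_sym.
Qed.

(** With [2j + d = D], the worse alternative of [card_ball_bound] allows [n + 2 - p] vertices, and
    [p >= k + 1] with [n <= 2k - 1] makes this at most [k]. *)
Lemma fits_girth D u :
  1 < D < k -> u \notin reach C -> D.-1 <= #|reach [set u]| -> fits D k G.
Proof.
move=> /andP[D1 Dk] uC uD x /central_rooted xr; rewrite /blob.
have DE := odd_double_half D.
have [||] := card_ball_bound (j := D./2) gG cw xr _ uC; first by lia.
  by rewrite -nFG; lia.
by rewrite -nFG; lia.
Qed.

(** F has as many core vertices as G, thus at least [p], and [card_cores_edge] leaves at most
    [n + 2 - p <= k] vertices for the ball. *)
Lemma fits_odd i : i.+1.*2.+1 < k ->
  fits i.+1.*2 k F -> fits i.+1.*2 k G -> fits i.+1.*2.+1 k F.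
Proof.
move=> ik fF fG [a b] ab; have : (a, b) \in core_darts F i.+1 by rewrite inE.
rewrite core_dartsE /blob (half_bit_double i.+1 true) => /andP[/nbext_mem[_ _ e] _].
have := card_cores_edge aF i.+1 e; rewrite (card_cores_eq fF fG).
rewrite [(a, b).1]/= [(a, b).2]/=; have := cores_large i.+1; lia.
Qed.

Lemma card_cycle_reach (A : {set G}) u :
  u \notin reach C -> A \subset reach C :\: C -> p + #|reach [set u]| + #|A| <= #|G|.
Proof.
move=> uC AC; have CR : C \subset reach C by apply/subsetP => y; apply: (reach_ball (j := 0)).
have dis : [disjoint C :|: A & reach [set u]].
  rewrite disjoint_subset; apply/subsetP => y yC; rewrite inE; apply: contra uC.
  rewrite reach_sym => uy; apply: (subsetP (reach_sub _) _ uy); rewrite sub1set.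
  move: y yC {uy}; apply/subsetP; rewrite subUset CR.
  by apply: subset_trans AC _; apply: subsetDl.
have disA : [disjoint C & A].
  rewrite disjoint_sym disjoint_subset; apply/subsetP => y /(subsetP AC) /setDP[_ yC].
  by rewrite inE.
have : #|(C :|: A) :|: reach [set u]| <= #|G| by apply: max_card.
have /eqP-> : #|(C :|: A) :|: reach [set u]| == #|C :|: A| + #|reach [set u]|.
  by rewrite (leq_card_setU (C :|: A) (reach [set u])).
have /eqP-> : #|C :|: A| == #|C| + #|A| by rewrite (leq_card_setU C A).
by rewrite (card_cycle_set cw); lia.
Qed.

Lemma off_cycle_notin i (a w : G) : a \in C -> w \in off_cycle p cy i a -> w \notin C.
Proof.
move=> aC; rewrite inE => /andP[/nbext_mem[_ _ aw] awN]; apply: contra awN => wC.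
exact: no_chord gG cw _ _ aC wC aw.
Qed.

(** Only two long branches at [a] can start along the cycle, so a third one leaves it. Coming back
    within [i] steps would create an ear with fewer than [p / 2] edges. *)
Lemma pendant_walk i (a : G) :
  0 < i -> 2 * i < p -> a \in C -> 2 < nbdeg setT i.-1 a ->
  exists x, [/\ nbwalk x i, x 0 = a & forall c, 0 < c <= i -> x c \notin C].
Proof.
move=> i0 ip aC a3; have := nbdeg_off_cycle cw i.-1 a; rewrite aC => H.
have /card_gt0P[w wO] : 0 < #|off_cycle p cy i.-1 a| by lia.
have wC := off_cycle_notin aC wO; move: wO; rewrite inE => /andP[/nbext_walk[x [xw x0 x1]] _].
rewrite prednK // in xw; exists x; split=> // c; elim/ltn_ind: c => c IH /andP[c0 ci].
have [->|c1] := eqVneq c 1; first by rewrite x1.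
apply/negP => xC; have := ear_bound gG cw (nbwalk_take xw ci) _ _ xC.
have xN : x 0 != x c by apply: (nbwalk_inj gG xw); lia.
rewrite x0 aC => /(_ _ isT) H'.
suff : p <= 2 * c by lia.
by apply: H'; [lia | rewrite -x0 | move=> b bc; apply: IH; lia].
Qed.

Lemma pendant_set i (a : G) (x : nat -> G) :
  i < p -> a \in C -> nbwalk x i -> x 0 = a -> (forall c, 0 < c <= i -> x c \notin C) ->
  [set x c.+1 | c : 'I_i] \subset reach C :\: C /\ #|[set x c.+1 | c : 'I_i]| = i.
Proof.
move=> ip aC xw x0 xC; split.
  apply/subsetP => _ /imsetP[c _ ->]; rewrite in_setD xC ?ltn_ord //=.
  have [xE _] := xw; have := walk_reach xE (leq0n i) (ltn_ord c); rewrite x0; apply/subsetP.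
  by apply: reach_sub; rewrite sub1set; apply: (reach_ball (j := 0)).
rewrite card_imset ?card_ord // => c c' xcc; apply/val_inj/eqP.
have := ltn_ord c; have := ltn_ord c' => c'i ci; have ip' : i <= p.-1 by lia.
have [lt|lt|//] := ltngtP c c'.
  by have := nbwalk_inj gG xw ip' (i := c.+1) (j := c'.+1); rewrite xcc eqxx; lia.
by have := nbwalk_inj gG xw ip' (i := c'.+1) (j := c.+1); rewrite xcc eqxx; lia.
Qed.

(** At most [e] edges lie off the cycle, so a centre with [e + 2] long branches is on the cycle and
    uses all of them. For [e > 0] two centres would need [2e] such edges. For [e = 0] and [i > 0]
    each centre carries a pendant path of [i] vertices, and there is room for only one. *)
Lemma twin_spiders i e (u a b : G) :
  ~ (#|F| = 5 /\ k = 3) -> u \notin reach C -> i.*2.+1 <= #|reach [set u]| ->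
  k = (e + 3) * i.+1 -> e = (#|core_darts G i| - 2 * p)./2 -> a != b ->
  core setT i.+1 a -> core setT i.+1 b ->
  e + 2 <= nbdeg setT i a -> e + 2 <= nbdeg setT i b ->
  (0 < i -> e + 3 <= nbdeg setT i.-1 a) -> (0 < i -> e + 3 <= nbdeg setT i.-1 b) -> False.
Proof.
move=> exc uC uR kE eE ab aK bK ad bd ad' bd'.
have De := odd_double_half (#|core_darts G i| - 2 * p); rewrite -eE in De.
have oa := card_off_cycle cw aK; have ob := card_off_cycle cw bK.
have na := nbdeg_off_cycle cw i a; have nb := nbdeg_off_cycle cw i b.
have aC : a \in C by move: na; case: (a \in C) => //; lia.
have bC : b \in C by move: nb; case: (b \in C) => //; lia.
rewrite aC in na; rewrite bC in nb.
have [e0|e0] := posnP e; last first.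
  have [dis|] := boolP [disjoint off_darts p cy i a & off_darts p cy i b].
    have : #|off_darts p cy i a :|: off_darts p cy i b| <= #|core_darts G i| - 2 * p.
      rewrite -(card_cycle_darts cw) -(setIidPr (cycle_darts_sub cw i)) -cardsD.
      by apply: subset_leq_card; rewrite subUset !off_darts_sub.
    have /eqP-> : #|off_darts p cy i a :|: off_darts p cy i b|
        == #|off_darts p cy i a| + #|off_darts p cy i b|.
      by rewrite (leq_card_setU (off_darts p cy i a) (off_darts p cy i b)).
    by rewrite !card_off_darts; lia.
  rewrite -setI_eq0 => /set0Pn[x]; rewrite in_setI => /andP[].
  rewrite !in_setU => /orP[]/imsetP[w wO ->] /orP[]/imsetP[w' w'O [E1 E2]].
  - by rewrite E1 eqxx in ab.
  - by have := off_cycle_notin aC wO; rewrite E2 bC.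
  - by have := off_cycle_notin aC wO; rewrite E1 bC.
  - by rewrite E2 eqxx in ab.
(* For [i = 0] one has [k = 3], so [p >= 4], and the extra component has a vertex: only [n = 5] is
   possible. *)
have [i0|i0] := posnP i.
  apply: exc; have := card_cycle_reach uC (sub0set _); rewrite cards0 -nFG.
  by move: kE uR; rewrite e0 i0; lia.
have ip : 2 * i < p by lia.
have [x [xw x0 xC]] : exists x, [/\ nbwalk x i, x 0 = a & forall c, 0 < c <= i -> x c \notin C].
  by apply: pendant_walk => //; have := ad' i0; lia.
have [y [yw y0 yC]] : exists x, [/\ nbwalk x i, x 0 = b & forall c, 0 < c <= i -> x c \notin C].
  by apply: pendant_walk => //; have := bd' i0; lia.
have ip' : i < p by lia.
have [xR xcard] := pendant_set ip' aC xw x0 xC; have [yR ycard] := pendant_set ip' bC yw y0 yC.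
set X := [set _ | _ : _] in xR xcard; set Y := [set _ | _ : _] in yR ycard.
(* Here [n <= 6i + 5], the cycle takes at least [3i + 4] vertices and the component of [u] at least
   [2i + 1]. *)
have XY : #|X :|: Y| <= i.
  have := @card_cycle_reach (X :|: Y) u uC; rewrite subUset xR yR -nFG => /(_ isT).
  by move: kE; rewrite e0; nia.
have XeY : X = Y.
  have EX : X = X :|: Y by apply/eqP; rewrite eqEcard subsetUl xcard.
  have EY : Y = X :|: Y by apply/eqP; rewrite eqEcard subsetUr ycard.
  by rewrite EX -EY.
have : x 1 \in Y by rewrite -XeY; apply/imsetP; exists (Ordinal i0).
case/imsetP => c _ xy; have ci := ltn_ord c.
(* Since [X = Y], the walk from [b] to [x 1] along [y], continued to [a], is an ear with at most
   [i + 1] edges, too few for [p > 3(i + 1)]. *)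
pose z d := if d is 0 then x 1 else a.
have zw : nbwalk z 1.
  by split=> // -[] // _ /=; rewrite sedge_sym -x0; case: xw => xE _; apply: xE.
have yzw : nbwalk (catw y c.+1 z) (c.+1 + 1).
  apply: nbwalk_cat (nbwalk_take yw ci) zw _ _ => // _ _ /=.
  case: (c : nat) ci => [|c'] ci; first by rewrite y0 eq_sym.
  by apply: contraTneq aC => <-; apply: yC; lia.
have := ear_bound gG cw yzw; rewrite catw_last // {1 2}/catw /= y0 => H.
suff : p <= 2 * (c.+1 + 1) by move: kE; rewrite e0; lia.
apply: H => //; first by lia.
  by rewrite eq_sym.
move=> d d1; rewrite /catw; case: ifP => dc; first by apply: yC; lia.
by lia.
Qed.

(* [e] edges of level [i.*2.+1] of G lie off the cycle, so [nbdeg] is at most [e + 2] in G.  A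
   large ball in F has [e + 3] legs of length [i.+1]; if the resulting spider has more than k
   vertices, then exactly k + 1, and cutting one tip yields several copies of a spider that occurs at
   most once in G. *)
Lemma fits_even i : i.+1.*2 < k -> ~ (#|F| = 5 /\ k = 3) ->
  (forall D, D < i.+1.*2 -> fits D k F /\ fits D k G) -> fits i.+1.*2 k G ->
  fits i.+1.*2 k F.
Proof.
move=> ik exc lower fG [v v'] vc.
have [vv' vK] : v = v' /\ core setT i.+1 v.
  by move: vc; rewrite /central odd_double doubleK => /andP[/eqP].
rewrite -{}vv' {vc v'} /blob doubleK /= setUid leqNgt; apply/negP => Xk.
set X := ball _ _ _ in Xk.
have E1k : 1 < i.+1.*2 <= k by lia.
have [u uC uR] := far_component E1k lower.
have [cF cG] : fits i.*2 k F /\ fits i.*2 k G by apply: lower; lia.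
have [dF dG] : fits i.*2.+1 k F /\ fits i.*2.+1 k G by apply: lower; lia.
have dE := card_core_darts_eq dF dG.
have cores0 : cores F i != set0.
  by rewrite -card_gt0 (card_cores_eq cF cG); have := cores_large i; lia.
have forest : #|core_darts F i| + 2 <= 2 * #|cores F i|.
  by apply: core_darts_forest => // w w' ww'; rewrite inE (core_darts_core ww').
have away := card_cores_vertex aF i v; rewrite -/X in away.
have Mp : 2 * p <= #|core_darts G i|.
  by rewrite -(card_cycle_darts cw); apply/subset_leq_card/cycle_darts_sub.
pose e := (#|core_darts G i| - 2 * p)./2.
have De := odd_double_half (#|core_darts G i| - 2 * p); rewrite -/e in De.
pose d := nbdeg setT i v; rewrite -/d in away.
(* The forest inequality yields at least [p + e + 1] cores; inserting this into [away] with
   [p >= k + 1] and [n <= 2k - 1] bounds [d] from below. *)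
have dlow : e + 2 + (#|X| - k) <= d by lia.
have [L legs] := legs_exist i v.
pose N := [set w | nbext setT i v w]; have Nd : #|N| = d by [].
have ND w : w \in N -> nbext setT i v w by rewrite inE.
have vN : v \notin N by rewrite inE; apply/negP => /nbext_mem[_ _]; rewrite sedge_irr.
have Xlow : 1 + d * i.+1 <= #|X|.
  have := card_spider aF legs v ND; rewrite (negbTE vN) addn0 Nd => <-.
  apply: subset_leq_card; apply: subset_trans (spider_sub_ball legs v ND) _.
  exact/ball_sub/subsetT.
(* Put [t = #|X| - k >= 1]: then [k + t >= 1 + (e + 2 + t)(i + 1)], and [t = 1] is the weakest
   case. *)
have klow : (e + 3) * i.+1 <= k by nia.
have [U UN Um] : exists2 U : {set F}, U \subset N & #|U| = e + 3 by apply: subset_of_card; lia.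
have UD w : w \in U -> nbext setT i v w by move=> /(subsetP UN); apply: ND.
have good_central (S : {set G}) x : good S i.+1.*2 x ->
    [/\ S \subset ball setT i.+1 [set x.1; x.2], x.1 = x.2 & core setT i.+1 x.1].
  move=> gS; have := good_sub_blob gS; rewrite /blob doubleK; split=> //.
    by move: gS; rewrite /good /central odd_double doubleK => /andP[/andP[/eqP]].
  by move: gS; rewrite /good /central odd_double doubleK => /andP[/andP[_ /core_sub->]]; rewrite ?subsetT.
(* A complete spider with [e + 3] legs that fits into a card would force [e + 3] long branches at a
   vertex of G. *)
have [kbig|ksmall] := leqP (1 + (e + 3) * i.+1) k.
  pose Q (H : sgraph) (S : {set H}) x := good S i.+1.*2 x && (e + 3 <= nbdeg S i x.1).
  have QI (G1 G2 : sgraph) (f : G1 -> G2) (S : {set G1}) w w' :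
      embeds_on f S -> w \in S -> w' \in S -> Q G2 (f @: S) (f w, f w') = Q G1 S (w, w').
    by move=> fS wS w'S; rewrite /Q good_emb // nbdeg_emb.
  have vU : v \notin U by apply: contra vN; apply/subsetP.
  have cardS := card_spider aF legs v UD; rewrite (negbTE vU) addn0 Um in cardS.
  have UvU : U :\ v = U by apply/setDidPl; rewrite disjoint_sym disjoints1.
  have := count_good_eq nFG kn FG QI; set A := [set _ | _]; set B := [set _ | _] => AB.
  have : 0 < #|B|.
    rewrite -AB card_gt0; apply/set0Pn; exists (spider i v L U v, (v, v)).
    rewrite inE /= cardS kbig !spider_root /Q spider_good //; last by rewrite UvU Um; lia.
    by have := spider_nbdeg legs v UD; rewrite UvU Um.
  case/card_gt0P => -[S x]; rewrite inE /= => /and4P[_ _ _ /andP[/good_central[_ _ xK] xd]].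
  have := nbdeg_off_cycle cw i x.1; have := card_off_cycle cw xK.
  have := leq_trans xd (nbdeg_sub i x.1 (subsetT S)).
  by case: (x.1 \in C); lia.
have kE : k = (e + 3) * i.+1 by lia.
pose Q (H : sgraph) (S : {set H}) x := [&& good S i.+1.*2 x, #|S| == k,
  e + 2 <= nbdeg S i x.1 & (i == 0) || (e + 3 <= nbdeg S i.-1 x.1)].
have QI (G1 G2 : sgraph) (f : G1 -> G2) (S : {set G1}) w w' :
    embeds_on f S -> w \in S -> w' \in S -> Q G2 (f @: S) (f w, f w') = Q G1 S (w, w').
  by move=> fS wS w'S; rewrite /Q good_emb // !nbdeg_emb // card_in_imset //; case: fS.
have := count_good_eq nFG kn FG QI; set A := [set _ | _]; set B := [set _ | _] => AB.
have inA t : t \in U -> (spider i v L U t, (v, v)) \in A.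
  move=> tU; have cardS := card_spider aF legs t UD; rewrite tU Um in cardS.
  have Ut : #|U :\ t| = e + 2 by have := cardsD1 t U; rewrite tU Um; lia.
  have Sk : #|spider i v L U t| = k by move: cardS kE; clear; lia.
  have U1 : 1 < #|U :\ t| by rewrite Ut addn2.
  have deg := spider_nbdeg legs t UD; rewrite Ut in deg.
  rewrite inE [(_, _).1]/= [(_, _).2]/= spider_root Sk leqnn /Q Sk eqxx spider_good // deg /=.
  by case: posnP => //= i0; have := spider_nbdeg_pred legs t UD i0; rewrite Um.
have : 1 < #|B|.
  rewrite -AB; have /card_gt1P[t [t' [tU t'U tt']]] : 1 < #|U| by lia.
  apply/card_gt1P; exists (spider i v L U t, (v, v)), (spider i v L U t', (v, v)).
  split; [exact: inA | exact: inA |].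
  rewrite xpair_eqE eqxx andbT; apply/eqP => E.
  have := spider_tip aF legs UD tU; rewrite E spider_leg // (negbTE tt') //.
case/card_gt1P => -[S x] [[S' x'] [yB y'B yy']].
(* An occurrence in G has [k] vertices while its blob has at most [k], so it fills the blob and is
   determined by its centre. *)
have full (S0 : {set G}) x0 : (S0, x0) \in B ->
    [/\ S0 = ball setT i.+1 [set x0.1; x0.2], x0.1 = x0.2, core setT i.+1 x0.1,
    e + 2 <= nbdeg setT i x0.1 & 0 < i -> e + 3 <= nbdeg setT i.-1 x0.1].
  rewrite inE /= => /and4P[_ _ _ /and4P[g0 /eqP S0k d0 d1]].
  have [S0b x0E x0K] := good_central _ _ g0; split=> //.
  - apply/eqP; rewrite eqEcard S0b S0k.
    have := fG x0; rewrite /blob doubleK; apply.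
    by move: g0 => /andP[/central_sub->]; rewrite ?subsetT.
  - exact: leq_trans d0 (nbdeg_sub i _ (subsetT S0)).
  move=> i0; move: d1; rewrite (negbTE (lt0n_neq0 i0)) /= => d1.
  exact: leq_trans d1 (nbdeg_sub _ _ (subsetT S0)).
have [SE xE xK xd xd'] := full _ _ yB; have [S'E x'E x'K x'd x'd'] := full _ _ y'B.
apply: (@twin_spiders i e u x.1 x'.1) => //.
apply: contraNneq yy' => xx'; have E : x = x'.
  by rewrite [x]surjective_pairing [x']surjective_pairing -xE -x'E xx'.
by rewrite SE S'E E.
Qed.

Lemma fits_all D : D < k -> ~ (#|F| = 5 /\ k = 3) -> fits D k F /\ fits D k G.
Proof.
move=> + exc; elim/ltn_ind: D => D IH Dk.
have [D1|D1] := leqP D 1.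
  have small (H : sgraph) : fits D k H.
    move=> x _; rewrite /blob; have -> : D./2 = 0 by case: D D1 {IH Dk} => [|[]].
    by apply: leq_trans k1; rewrite cards2; case: (_ != _).
  by split.
have lower D' : D' < D -> fits D' k F /\ fits D' k G by move=> D'D; apply: IH => //; lia.
have D1k : 1 < D <= k by rewrite D1 ltnW.
have [u uC uD] := far_component D1k lower.
have fG : fits D k G by apply: fits_girth uC uD; rewrite D1.
split=> //; have := odd_double_half D; case: (boolP (odd D)) => _ DE.
  pose j := D./2.-1; have Dj : D = j.+1.*2.+1 by rewrite /j; lia.
  have [fF' fG'] : fits j.+1.*2 k F /\ fits j.+1.*2 k G by apply: lower; lia.
  by rewrite Dj; apply: fits_odd => //; lia.
pose j := D./2.-1; have Dj : D = j.+1.*2 by rewrite /j; lia.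
by rewrite Dj; apply: fits_even; rewrite -?Dj.
Qed.

(** The extra component has at least [k - 1] vertices and the cycle at least [k + 1], together more
    than [2k - 1]. *)
Lemma comparison_absurd : ~ (#|F| = 5 /\ k = 3) -> False.
Proof.
move=> exc; have k1k : 1 < k <= k by rewrite k1 leqnn.
have [u uC uk] := far_component k1k (fun D Dk => fits_all Dk exc).
by have := card_cycle_reach uC (sub0set _); rewrite cards0 -nFG; lia.
Qed.

End Comparison.

(** * Excluding short cycles and choosing a shortest one *)

Lemma cycle_set_core (G : sgraph) (cy : nat -> G) p s :
  cyclic_walk cy p -> core (cycle_set cy p) 1 (cy s).
Proof.
move=> cw; have [p2 cyE cyq] := cw.
have inC t : cy t \in cycle_set cy p by apply/(cycle_setP _ cw); exists t.
have prev : cy (s + p.-1).+1 = cy s.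
  by rewrite -addnS prednK ?(ltn_trans _ p2) // -[p in _ + p]mul1n (cy_shift cw).
have back : sedge (cy s) (cy (s + p.-1)).
  by rewrite sedge_sym -[X in sedge _ X]prev.
apply/card_gt1P; exists (cy s.+1), (cy (s + p.-1)).
rewrite !inE /= !inC cyE back; split=> //.
by rewrite cyq -[s.+1]addn1 eqn_modDl !modn_small; lia.
Qed.

(** The pattern counted is a nonempty set whose vertices all have two neighbours inside it, the
    marked pair witnessing nonemptiness. The vertices of a short cycle form such a set, and a forest
    contains none. *)
Lemma no_short_cycle k (F G : sgraph) (c : seq G) :
  acyclic F -> #|F| = #|G| -> k <= #|F| -> same_deck k F G ->
  2 < size c -> ucycle (@sedge G) c -> k < size c.
Proof.
move=> aF nFG kn FG c3 cc; rewrite ltnNge; apply/negP => ck.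
have [cy cw] := cyclic_walk_of_ucycle c3 cc.
pose Q (H : sgraph) (S : {set H}) (x : H * H) := [forall w, (w \in S) ==> core S 1 w].
have QI (G1 G2 : sgraph) (f : G1 -> G2) (S : {set G1}) w w' :
    embeds_on f S -> w \in S -> w' \in S -> Q G2 (f @: S) (f w, f w') = Q G1 S (w, w').
  move=> fS _ _; apply/forall_inP/forall_inP => H y yS; last first.
    by case/imsetP: yS => z zS ->; rewrite core_emb // H.
  by rewrite -(core_emb fS) // H // imset_f.
have := count_good_eq nFG kn FG QI; set A := [set _ | _]; set B := [set _ | _] => AB.
have : 0 < #|B|.
  apply/card_gt0P; exists (cycle_set cy (size c), (cy 0, cy 0)).
  have c0 : cy 0 \in cycle_set cy (size c) by apply/(cycle_setP _ cw); exists 0.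
  rewrite inE [(_, _).1]/= [(_, _).2]/= c0 (card_cycle_set cw) ck /=.
  by apply/forall_inP => y /(cycle_setP _ cw)[s ->]; apply: cycle_set_core.
rewrite -AB => /card_gt0P[[S x]]; rewrite inE /= => /and4P[_ xS _ /forall_inP SQ].
have S0 : S != set0 by apply/set0Pn; exists x.1.
have [v vS] := forest_min_degree aF S0; rewrite leqNgt => /negP[].
apply: leq_trans (SQ v vS) _; apply/subset_leq_card/subsetP => u.
by rewrite !inE => /nbext_mem[_ -> ->].
Qed.

Lemma shortest_cycle (G : sgraph) (c : seq G) :
  2 < size c -> ucycle (@sedge G) c ->
  exists c' : seq G, [/\ 2 < size c', ucycle (@sedge G) c' & girth_gt G (size c').-1].
Proof.
move=> c3 cc.
pose has_cycle m := (2 < m) && [exists t : m.-tuple G, ucycleb (@sedge G) t].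
have hasP (d : seq G) : 2 < size d -> ucycle (@sedge G) d -> has_cycle (size d).
  by move=> d3 dc; rewrite /has_cycle d3; apply/existsP; exists (in_tuple d).
have ex : exists m, has_cycle m by exists (size c); apply: hasP.
case: (ex_minnP ex) => m /andP[m3 /existsP[t tc]] mmin.
exists t; rewrite size_tuple; split=> // d d3 dc.
by have := mmin _ (hasP d d3 dc); lia.
Qed.

Theorem theorem1p2 (l n : nat) (hl : 1 <= l) (hn : 2 * l + 1 <= n)
  (hln : (n, l) <> (5, 2)) : recognizable l n acyclic.
Proof.
move=> F G Fn Gn aF FG [c [c3 cc]].
have [d [d3 dc dmin]] := shortest_cycle c3 cc.
have [cy cw] := cyclic_walk_of_ucycle d3 dc.
have FGn : #|F| = #|G| by rewrite Fn Gn.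
have kn : n - l <= #|F| by rewrite Fn leq_subr.
have kd := no_short_cycle aF FGn kn FG d3 dc.
apply: (comparison_absurd aF FGn kn _ _ FG dmin cw kd); rewrite ?Fn; [lia | lia |].
by case=> n5 k3; apply: hln; congr (_, _); lia.
Qed.
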